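(* Let $p$ be a prime and $q$ a prime power with $p\nmid q$ and $q\not\equiv1 \pmod{p}$, and let $d$ be the multiplicative order of $q$ modulo $p$. Then $$\exp\left(h(q,z)-\frac{1}{d}h(q^d,z^d)\right)\in \mathbb{Z}_p[[z]].$$
   Context: For a number $Q$, $h(Q,z)=\log f(Q,z)\in\mathbb{Q}[[z]]$, where $f(Q,z)=\sum_{n\geq0}\frac{(-1)^nz^n}{Q^{\binom{n}{2}}(Q;Q)_n}$ and $(Q;Q)_n=\prod_{i=1}^n(1-Q^i)$. $\mathbb{Z}_p$ denotes the $p$-adic integers. *)

(* Defs.v *)
From HB Require Import structures.
From mathcomp Require Import all_boot all_order all_algebra.
From mathcomp Require Import fraction boolp.

Set Implicit Arguments.
Unset Strict Implicit.
Unset Printing Implicit Defensive.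

Import GRing.Theory.
Local Open Scope ring_scope.

(* A series is its sequence of coefficients: F n is the coefficient of z^n. *)
Definition fps (R : Type) := nat -> R.

Section FormalPowerSeries.
Variable R : pzRingType.
Implicit Types F G : fps R.

Definition fps_one : fps R := fun n => (n == 0%N)%:R.
Definition fps_sub F G : fps R := fun n => F n - G n.
Definition fps_scale (c : R) F : fps R := fun n => c * F n.
Definition fps_mul F G : fps R := fun n => \sum_(i < n.+1) F i * G (n - i)%N.
Definition fps_pow F (k : nat) : fps R := iter k (fps_mul F) fps_one.

(* F (G(z)) = \sum_k F_k G(z)^k, for G without constant term: then z^k divides
   G(z)^k, so that only the terms k <= n contribute to the coefficient of
   z^n. *)
Definition fps_comp F G : fps R :=
  fun n => \sum_(k < n.+1) F k * fps_pow G k n.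

(* F (z^d), for d > 0. *)
Definition fps_substX (d : nat) F : fps R :=
  fun n => if (d %| n)%N then F (n %/ d)%N else 0.

End FormalPowerSeries.

(* exp (G(z)) = \sum_k G(z)^k / k!, for G without constant term. *)
Definition fps_exp (G : fps rat) : fps rat :=
  fps_comp (fun k => (k`!)%:R^-1) G.

(* log (F(z)) = \sum_(k > 0) (-1)^(k+1) (F(z) - 1)^k / k, for F with constant
   term 1; the term k = 0 is zero since 0^-1 = 0. *)
Definition fps_log (F : fps rat) : fps rat :=
  fps_comp (fun k => (-1) ^+ k.+1 / k%:R) (fps_sub F (fps_one rat)).

(* (Q; Q)_n *)
Definition qpoch (Q : rat) (n : nat) : rat := \prod_(1 <= i < n.+1) (1 - Q ^+ i).

Definition fser (Q : rat) : fps rat :=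
  fun n => (-1) ^+ n / (Q ^+ 'C(n, 2) * qpoch Q n).

Definition hser (Q : rat) : fps rat := fps_log (fser Q).

Definition prime_power (q : nat) : Prop :=
  exists r k : nat, [/\ prime r, (0 < k)%N & q = (r ^ k)%N].

Definition Zpow_red (p n : nat) (x : 'Z_(p ^ n.+2)) : 'Z_(p ^ n.+1) :=
  (x : nat)%:R.

(* Z_p, the inverse limit of the rings Z/p^(n+1); 'Z_(p ^ n.+1) is Z/p^(n+1)
   since p^(n+1) > 1. The primality proof is a parameter for the sake of the
   canonical structures: the inverse limit is an integral domain because
   p is prime. *)
Record padic_int (p : nat) (p_prime : prime p) := PadicInt {
  padic_proj :> forall n, 'Z_(p ^ n.+1);
  padic_projP : forall n, Zpow_red (padic_proj n.+1) = padic_proj n }.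

HB.instance Definition _ p p_prime := gen_eqMixin (@padic_int p p_prime).
HB.instance Definition _ p p_prime := gen_choiceMixin (@padic_int p p_prime).

Section PadicIntegers.
Variables (p : nat) (p_prime : prime p).
Local Notation Zp := (padic_int p_prime).
Implicit Types a b c : Zp.

Lemma padic_int_eq a b : (forall n, a n = b n) -> a = b.
Proof.
case: a b => a aP [b bP] /= eq_ab.
have eqab : a = b by apply: functional_extensionality_dep.
by case: _ / eqab in bP *; congr PadicInt; apply: Prop_irrelevance.
Qed.

Lemma Zpow_gt1 n : (1 < p ^ n.+1)%N.
Proof. by rewrite -(exp1n n.+1) ltn_exp2r ?prime_gt1. Qed.

Lemma Zpow_red_nat n m : Zpow_red (m%:R : 'Z_(p ^ n.+2)) = m%:R.
Proof.
rewrite /Zpow_red val_Zp_nat ?Zpow_gt1 //; apply: ord_inj.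
by rewrite !val_Zp_nat ?Zpow_gt1 // modn_dvdm // dvdn_exp2l.
Qed.

Lemma Zpow_red1 n : Zpow_red (1 : 'Z_(p ^ n.+2)) = 1.
Proof. exact: (Zpow_red_nat n 1). Qed.

Lemma Zpow_redD n : {morph @Zpow_red p n : x y / x + y}.
Proof. by move=> x y; rewrite -[x]natr_Zp -[y]natr_Zp -natrD !Zpow_red_nat natrD. Qed.

Lemma Zpow_redM n : {morph @Zpow_red p n : x y / x * y}.
Proof. by move=> x y; rewrite -[x]natr_Zp -[y]natr_Zp -natrM !Zpow_red_nat natrM. Qed.

Lemma Zpow_redN n : {morph @Zpow_red p n : x / - x}.
Proof.
move=> x; apply/eqP; rewrite -subr_eq0 opprK -Zpow_redD addNr.
by rewrite (Zpow_red_nat n 0).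
Qed.

Definition padic_zero : Zp :=
  @PadicInt p p_prime (fun=> 0) (fun n => Zpow_red_nat n 0).
Definition padic_one : Zp :=
  @PadicInt p p_prime (fun=> 1) Zpow_red1.

Fact padic_opp_proof a n : Zpow_red (- a n.+1) = - a n.
Proof. by rewrite Zpow_redN padic_projP. Qed.
Definition padic_opp a : Zp := @PadicInt p p_prime _ (padic_opp_proof a).

Fact padic_add_proof a b n : Zpow_red (a n.+1 + b n.+1) = a n + b n.
Proof. by rewrite Zpow_redD !padic_projP. Qed.
Definition padic_add a b : Zp := @PadicInt p p_prime _ (padic_add_proof a b).

Fact padic_mul_proof a b n : Zpow_red (a n.+1 * b n.+1) = a n * b n.
Proof. by rewrite Zpow_redM !padic_projP. Qed.
Definition padic_mul a b : Zp := @PadicInt p p_prime _ (padic_mul_proof a b).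

Fact padic_addA : associative padic_add.
Proof. by move=> a b c; apply: padic_int_eq => n; apply: addrA. Qed.
Fact padic_addC : commutative padic_add.
Proof. by move=> a b; apply: padic_int_eq => n; apply: addrC. Qed.
Fact padic_add0 : left_id padic_zero padic_add.
Proof. by move=> a; apply: padic_int_eq => n; apply: add0r. Qed.
Fact padic_addN : left_inverse padic_zero padic_opp padic_add.
Proof. by move=> a; apply: padic_int_eq => n; apply: addNr. Qed.

HB.instance Definition _ := GRing.isZmodule.Build Zp
  padic_addA padic_addC padic_add0 padic_addN.

Fact padic_mulA : associative padic_mul.
Proof. by move=> a b c; apply: padic_int_eq => n; apply: mulrA. Qed.
Fact padic_mulC : commutative padic_mul.
Proof. by move=> a b; apply: padic_int_eq => n; apply: mulrC. Qed.
Fact padic_mul1 : left_id padic_one padic_mul.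
Proof. by move=> a; apply: padic_int_eq => n; apply: mul1r. Qed.
Fact padic_mulDl : left_distributive padic_mul padic_add.
Proof. by move=> a b c; apply: padic_int_eq => n; apply: mulrDl. Qed.
Fact padic_one_neq0 : padic_one != 0.
Proof. by apply/eqP => /(congr1 (fun a : Zp => a 0)) /eqP; rewrite oner_eq0. Qed.

HB.instance Definition _ := GRing.Zmodule_isComNzRing.Build Zp
  padic_mulA padic_mulC padic_mul1 padic_mulDl padic_one_neq0.

Definition padic_unit : {pred Zp} := fun a => `[< exists b : Zp, b * a = 1 >].
Definition padic_inv a : Zp :=
  if pselect (exists b : Zp, b * a = 1) is left h then projT1 (cid h) else a.

Fact padic_mulV : {in padic_unit, left_inverse 1 padic_inv *%R}.
Proof.
move=> a /asboolP a_unit; rewrite /padic_inv.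
by case: pselect => // h; case: cid.
Qed.
Fact padic_unitP a b : b * a = 1 -> padic_unit a.
Proof. by move=> ba1; apply/asboolP; exists b. Qed.
Fact padic_inv_out : {in [predC padic_unit], padic_inv =1 id}.
Proof.
move=> a /asboolP a_nunit; rewrite /padic_inv.
by case: pselect => // /a_nunit.
Qed.

HB.instance Definition _ := GRing.ComNzRing_hasMulInverse.Build Zp
  padic_mulV padic_unitP padic_inv_out.

Lemma padic_proj_dvd a n k : (p ^ n.+1 %| a (n + k)%N)%N = (a n == 0).
Proof.
elim: k => [|k <-].
  rewrite addn0 -{2}[a n]natr_Zp -val_eqE /= val_Zp_nat ?Zpow_gt1 //.
rewrite -(padic_projP a (n + k)) /Zpow_red addnS.
by rewrite val_Zp_nat ?Zpow_gt1 // /dvdn modn_dvdm // dvdn_exp2l // ltnS leq_addr.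
Qed.

Fact padic_integral_domain a b : a * b = 0 -> (a == 0) || (b == 0).
Proof.
move=> ab0; apply: contraT; rewrite negb_or => /andP[a_neq0 b_neq0].
have exn (c : Zp) : c != 0 -> exists n, c n != 0.
  move=> c0; apply: contrapT => /forallNP h; case/eqP: c0.
  by apply: padic_int_eq => n; apply/eqP; move: (h n) => /negP; rewrite negbK.
have [n an] := exn a a_neq0; have [m bm] := exn b b_neq0.
rewrite -(padic_proj_dvd a n m) in an; rewrite -(padic_proj_dvd b m n) in bm.
have abnm0 : a (n + m)%N * b (n + m)%N = 0.
  by have /(congr1 (fun c : Zp => c (n + m)%N)) := ab0.
have : (a (n + m) * b (n + m))%N%:R = 0 :> 'Z_(p ^ (n + m).+1).
  by rewrite natrM !natr_Zp.
move/(congr1 (@nat_of_ord _))/eqP.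
rewrite val_Zp_nat ?Zpow_gt1 // -/(dvdn _ _).
rewrite [(m + n)%N]addnC in bm.
move: an bm; set u := nat_of_ord _; set v := nat_of_ord _ => un vm.
have u_gt0 : (0 < u)%N by case: (u) un => //; rewrite dvdn0.
have v_gt0 : (0 < v)%N by case: (v) vm => //; rewrite dvdn0.
rewrite !pfactor_dvdn // ?muln_gt0 ?u_gt0 // -?leqNgt in un vm *.
by rewrite lognM // ltnNge leq_add.
Qed.

HB.instance Definition _ :=
  GRing.ComUnitRing_isIntegral.Build Zp padic_integral_domain.

Lemma padic_proj_nat (m n : nat) : (m%:R : Zp) n = m%:R.
Proof. by elim: m => // m IHm; rewrite -!natr1 -IHm. Qed.

Lemma padic_int_natr_eq0 (m : nat) : (m%:R == 0 :> Zp) = (m == 0%N).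
Proof.
case: m => [|m]; rewrite ?eqxx //; apply/eqP => /(congr1 (fun c : Zp => c m)).
rewrite padic_proj_nat => /(congr1 (@nat_of_ord _)).
by rewrite val_Zp_nat ?Zpow_gt1 // modn_small // ltn_expl ?prime_gt1.
Qed.

End PadicIntegers.

Notation padic p_prime := {fraction padic_int p_prime}.

(* F, which has rational coefficients, belongs to Z_p[[z]]: it has the same
   image in Q_p[[z]] as a series G over Z_p. As Q_p has characteristic 0, ratr
   is the embedding of the rationals into Q_p. *)
Definition in_padic_int_fps (p : nat) (p_prime : prime p) (F : fps rat) : Prop :=
  exists G : fps (padic_int p_prime),
    forall n, ratr (F n) = tofrac (G n) :> padic p_prime.

Lemma padic_natr_eq0 p (p_prime : prime p) (m : nat) :
  (m%:R == 0 :> padic p_prime) = (m == 0%N).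
Proof.
rewrite -(padic_int_natr_eq0 p_prime).
by rewrite -(rmorph_nat (@tofrac (padic_int p_prime))) tofrac_eq0.
Qed.

(* Main.v *)
(* Write x = 1/q. The series f(q, z) = \sum_n x^(n^2) z^n / (x; x)_n satisfies
   f(z) = f(x z) + x z f(x^2 z), so R(z) = f(x z) / f(z) is the Rogers-Ramanujan
   continued fraction R(z) = 1 - x z R(z) R(x z), with coefficients in Z[x];
     hence
   it is a product of factors (1 - x^j z^m)^(- w_(m, j)) with w_m(x) in Z[x].

   At a primitive e-th root of unity zeta, the product of the R(zeta^i z), i < e,
   is the value R_1(z^e) at x = 1: both are the power series root of
   Y = 1 - z^e Y^2, by computing trace and determinant of the product of e
   transfer matrices. Comparing exponents, w_m vanishes at all m-th roots of unity
   except 1, so w_m = v_m (1 + x + ... + x^(m-1)) with v_m in Z[x]. Therefore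
     h(q, z) = \sum_(m, k) v_m(x^k) / (x^k - 1) z^(m k) / k,
   and subtracting h(q^d, z^d) / d removes the terms with d | k, which are those
   where the denominator x^k - 1 is not a p-adic unit. For the remaining ones,
   x^k = x^(k / p) modulo the p-part of k gives Dwork's congruences, hence the
   integrality of the exponential. *)
From HB Require Import structures.
Require Import Defs.
From mathcomp Require Import all_boot all_order all_algebra all_field cyclic.
From mathcomp Require Import boolp ring zify.

Set Implicit Arguments.
Unset Strict Implicit.
Unset Printing Implicit Defensive.

Import GRing.Theory Num.Theory.
Local Open Scope ring_scope.

(** * The ring of formal power series *)

Lemma fps_ext (R : Type) (F G : fps R) : F =1 G -> F = G.
Proof. by move=> FG; apply: functional_extensionality_dep. Qed.

Section FpsRing.
Variable R : comNzRingType.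
Implicit Types F G H : fps R.

HB.instance Definition _ := gen_eqMixin (fps R).
HB.instance Definition _ := gen_choiceMixin (fps R).

Definition fps_zero : fps R := fun=> 0.
Definition fps_opp F : fps R := fun n => - F n.
Definition fps_add F G : fps R := fun n => F n + G n.

Fact fps_addA : associative fps_add.
Proof. by move=> F G H; apply: fps_ext => n; apply: addrA. Qed.
Fact fps_addC : commutative fps_add.
Proof. by move=> F G; apply: fps_ext => n; apply: addrC. Qed.
Fact fps_add0 : left_id fps_zero fps_add.
Proof. by move=> F; apply: fps_ext => n; apply: add0r. Qed.
Fact fps_addN : left_inverse fps_zero fps_opp fps_add.
Proof. by move=> F; apply: fps_ext => n; apply: addNr. Qed.

HB.instance Definition _ := GRing.isZmodule.Build (fps R)
  fps_addA fps_addC fps_add0 fps_addN.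

(** In degree below [N], products of series agree with products of truncations, so the ring laws are
    inherited from [{poly R}]. *)
Definition fps_trunc N F : {poly R} := \poly_(i < N) F i.

Lemma fps_mul_trunc N F G n :
  (n < N)%N -> fps_mul F G n = (fps_trunc N F * fps_trunc N G)`_n.
Proof.
move=> nN; rewrite coefM; apply: eq_bigr => i _; rewrite !coef_poly.
by rewrite !ifT //; apply: leq_ltn_trans nN; rewrite ?leq_subr // -ltnS.
Qed.

Lemma coefM_eq (P P' Q Q' : {poly R}) n :
  (forall i, (i <= n)%N -> P`_i = P'`_i) ->
  (forall i, (i <= n)%N -> Q`_i = Q'`_i) -> (P * Q)`_n = (P' * Q')`_n.
Proof.
move=> PP QQ; rewrite !coefM; apply: eq_bigr => i _.
by rewrite PP ?QQ ?leq_subr // -ltnS.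
Qed.

Lemma fps_trunc_mul N F G i : (i < N)%N ->
  (fps_trunc N (fps_mul F G))`_i = (fps_trunc N F * fps_trunc N G)`_i.
Proof. by move=> iN; rewrite coef_poly iN; apply: fps_mul_trunc. Qed.

Fact fps_mulA : associative (@fps_mul R).
Proof.
move=> F G H; apply: fps_ext => n; rewrite !(fps_mul_trunc _ _ (ltnSn n)).
transitivity ((fps_trunc n.+1 F * (fps_trunc n.+1 G * fps_trunc n.+1 H))`_n).
  by apply: coefM_eq => // i ni; apply: fps_trunc_mul.
by rewrite mulrA; apply: coefM_eq => // i ni; rewrite fps_trunc_mul.
Qed.
Fact fps_mulC : commutative (@fps_mul R).
Proof.
move=> F G; apply: fps_ext => n.
by rewrite !(fps_mul_trunc _ _ (ltnSn n)) mulrC.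
Qed.
Fact fps_mul1 : left_id (fps_one R) (@fps_mul R).
Proof.
move=> F; apply: fps_ext => n; rewrite /fps_mul big_ord_recl /= subn0.
by rewrite mul1r big1 ?addr0 // => i _; rewrite mul0r.
Qed.
Fact fps_mulDl : left_distributive (@fps_mul R) +%R.
Proof.
move=> F G H; apply: fps_ext => n; rewrite /fps_mul -[RHS]big_split /=.
by apply: eq_bigr => i _; apply: mulrDl.
Qed.
Fact fps_one_neq0 : fps_one R != 0.
Proof. by apply/eqP => /(congr1 (fun F => F 0)) /eqP; rewrite oner_eq0. Qed.

HB.instance Definition _ := GRing.Zmodule_isComNzRing.Build (fps R)
  fps_mulA fps_mulC fps_mul1 fps_mulDl fps_one_neq0.

Lemma fpsD F G n : (F + G) n = F n + G n. Proof. by []. Qed.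
Lemma fpsN F n : (- F) n = - F n. Proof. by []. Qed.
Lemma fpsB F G n : (F - G) n = F n - G n. Proof. by []. Qed.
Lemma fps0 n : (0 : fps R) n = 0. Proof. by []. Qed.
Lemma fps1 n : (1 : fps R) n = (n == 0%N)%:R. Proof. by []. Qed.
Lemma fpsM F G n : (F * G) n = \sum_(i < n.+1) F i * G (n - i)%N.
Proof. by []. Qed.
Lemma fpsM0 F G : (F * G) 0 = F 0 * G 0.
Proof. by rewrite fpsM big_ord1. Qed.
Lemma fps_sum I (s : seq I) (P : pred I) (E : I -> fps R) n :
  (\sum_(i <- s | P i) E i) n = \sum_(i <- s | P i) E i n.
Proof. by elim/big_rec2: _ => // i a F _ <-. Qed.
Lemma fpsMn F k n : (F *+ k) n = F n *+ k.
Proof. by elim: k => // k IHk; rewrite !mulrS fpsD IHk. Qed.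
Lemma fpsX0 F k : (F ^+ k) 0 = F 0 ^+ k.
Proof. by elim: k => // k IHk; rewrite !exprS fpsM0 IHk. Qed.
Lemma fps_powE F k : fps_pow F k = F ^+ k.
Proof. by elim: k => // k IHk; rewrite exprS -IHk. Qed.

Lemma fpsM_eq F F' G G' n :
  (forall i, (i <= n)%N -> F i = F' i) ->
  (forall i, (i <= n)%N -> G i = G' i) -> (F * G) n = (F' * G') n.
Proof.
move=> FF GG; rewrite !fpsM; apply: eq_bigr => i _.
by rewrite FF ?GG ?leq_subr // -ltnS.
Qed.

(** Multiplication by a series without constant term is thus a contraction, which is what the
    fixed-point equations below rest on. *)
Lemma fpsM_eqr F G G' n : F 0 = 0 ->
  (forall i, (i < n)%N -> G i = G' i) -> (F * G) n = (F * G') n.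
Proof.
move=> F0 GG; rewrite !fpsM !big_ord_recl F0 !mul0r; congr (_ + _).
by apply: eq_bigr => i _; rewrite GG // lift0; case: i => /= i; lia.
Qed.

Definition fps_monom (c : R) (k : nat) : fps R := fun n => if n == k then c else 0.

Lemma fps_monomM c k F n :
  (fps_monom c k * F) n = if (k <= n)%N then c * F (n - k)%N else 0.
Proof.
rewrite fpsM; case: leqP => kn.
  rewrite (bigD1 (inord k)) //= inordK // /fps_monom eqxx big1 ?addr0 // => i.
  by rewrite -val_eqE /= inordK // => /negPf->; rewrite mul0r.
apply: big1 => i _; rewrite /fps_monom ifF ?mul0r //.
by apply/negP => /eqP ik; have := ltn_ord i; rewrite ik; lia.
Qed.

Lemma fps_monomMmonom c k c' k' :
  fps_monom c k * fps_monom c' k' = fps_monom (c * c') (k + k').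
Proof.
apply: fps_ext => n; rewrite fps_monomM /fps_monom.
case: leqP => kn; last by rewrite ifF //; lia.
have -> : (n - k == k')%N = (n == k + k')%N by lia.
by case: eqP; rewrite ?mulr0.
Qed.

Lemma fpsX_small F k n : F 0 = 0 -> (n < k)%N -> (F ^+ k) n = 0.
Proof.
move=> F0; elim: k n => // k IHk n nk.
rewrite exprS fpsM big_ord_recl F0 mul0r add0r big1 // => i _.
by rewrite IHk ?mulr0 // lift0; case: i => /= i; lia.
Qed.

Lemma fps_comp_wide F G N n : G 0 = 0 -> (n <= N)%N ->
  fps_comp F G n = \sum_(k < N.+1) F k * (G ^+ k) n.
Proof.
move=> G0 nN; rewrite /fps_comp (big_ord_widen_cond N.+1 predT
  (fun k => F k * fps_pow G k n)) // big_mkcond; apply: eq_bigr => k _.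
rewrite fps_powE; case: ifP => //= /negbT; rewrite -leqNgt => nk.
by rewrite fpsX_small ?mulr0.
Qed.

Lemma fpsM_eq0_unit F G : F 0 = 1 -> F * G = 0 -> G = 0.
Proof.
move=> F0 FG; apply: fps_ext => n.
elim/ltn_ind: n => n IHn.
have := congr1 (fun H => H n) FG; rewrite /= fpsM big_ord_recl F0 mul1r subn0.
rewrite big1 ?addr0 // => i _; rewrite IHn ?mulr0 // lift0.
by case: i => /= i; lia.
Qed.

Lemma fps_mulI F G H : F 0 = 1 -> F * G = F * H -> G = H.
Proof.
move=> F0 FGH; apply/eqP; rewrite -subr_eq0; apply/eqP.
by apply: (fpsM_eq0_unit F0); rewrite mulrBr FGH subrr.
Qed.

End FpsRing.

(** * Fixed points of contracting operators on series *)

Section FixedPoint.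
Variables (T : Type) (Psi : fps T -> fps T).
Hypothesis Psi_contr : forall F G n,
  (forall i, (i < n)%N -> F i = G i) -> Psi F n = Psi G n.

(** Iterating [Psi] stabilises coefficient [n] after [n.+1] steps, whatever the start; the fixed
    point is the diagonal of the stable values. *)
Lemma fps_fix (x0 : T) : exists F : fps T, F = Psi F.
Proof.
pose A k : fps T := iter k Psi (fun=> x0).
have stab k l n : (n < k)%N -> (n < l)%N -> A k n = A l n.
  elim/ltn_ind: n k l => n IHn [|k] [|l] // nk nl.
  by apply: Psi_contr => i ni; apply: IHn => //; lia.
exists (fun n => A n.+1 n); apply: fps_ext => n.
change (Psi (A n) n = Psi (fun n => A n.+1 n : T) n).
by apply: Psi_contr => i ni; apply: stab.
Qed.

Lemma fps_fix_uniq (F G : fps T) : F = Psi F -> G = Psi G -> F = G.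
Proof.
move=> FE GE; apply: fps_ext => n; elim/ltn_ind: n => n IHn.
by rewrite FE GE; apply: Psi_contr.
Qed.

End FixedPoint.

Section Inverse.
Variable R : comNzRingType.
Implicit Types F G : fps R.

(** The quotient is the fixed point of H = G - (F - 1) H, where F - 1 has no constant term. *)
Lemma fps_div_ex F G : F 0 = 1 -> exists H, F * H = G.
Proof.
move=> F0.
have [|H HE] := @fps_fix R (fun H : fps R => G - (F - 1) * H) _ 0.
  move=> H H' n HH'; rewrite !fpsB; congr (_ - _).
  by apply: fpsM_eqr => //; rewrite fpsB F0 subrr.
exists H.
have -> : F * H = H + (F - 1) * H by ring.
by rewrite {1}HE subrK.
Qed.

End Inverse.

(** * Derivation, dilation and logarithmic derivative *)

Section Operators.
Variable R : comNzRingType.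
Implicit Types F G : fps R.

(** The Euler operator z d/dz, which preserves degrees and so avoids index shifts. *)
Definition fps_theta F : fps R := fun n => F n *+ n.

(* F (x z) *)
Definition fps_dil (x : R) F : fps R := fun n => x ^+ n * F n.

Lemma fps_thetaM F G :
  fps_theta (F * G) = fps_theta F * G + F * fps_theta G.
Proof.
apply: fps_ext => n; rewrite fpsD !fpsM /fps_theta -sumrMnl -big_split /=.
apply: eq_bigr => i _; rewrite mulrnAl mulrnAr -mulrnDr subnKC // -ltnS.
exact: ltn_ord.
Qed.

Lemma fps_thetaD F G : fps_theta (F + G) = fps_theta F + fps_theta G.
Proof. by apply: fps_ext => n; rewrite /fps_theta !fpsD mulrnDl. Qed.

Lemma fps_thetaX F k : fps_theta (F ^+ k.+1) = F ^+ k * fps_theta F *+ k.+1.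
Proof.
elim: k => [|k IHk]; first by rewrite expr0 mul1r expr1.
by rewrite exprS fps_thetaM IHk (exprS F k); ring.
Qed.

Lemma fps_theta_const0 F : fps_theta F 0 = 0.
Proof. by rewrite /fps_theta mulr0n. Qed.

Lemma fps_dil_id F : fps_dil 1 F = F.
Proof. by apply: fps_ext => n; rewrite /fps_dil expr1n mul1r. Qed.

Lemma fps_dil_dil x y F : fps_dil x (fps_dil y F) = fps_dil (x * y) F.
Proof. by apply: fps_ext => n; rewrite /fps_dil exprMn mulrA. Qed.

Lemma fps_dil0 x F : fps_dil x F 0 = F 0.
Proof. by rewrite /fps_dil expr0 mul1r. Qed.

Lemma fps_dil_monom x c (k : nat) :
  fps_dil x (fps_monom c k) = fps_monom (x ^+ k * c) k.
Proof.
by apply: fps_ext => n; rewrite /fps_dil /fps_monom; case: eqP => [->|];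
  rewrite ?mulr0.
Qed.

Lemma fps_theta_dil x F : fps_theta (fps_dil x F) = fps_dil x (fps_theta F).
Proof. by apply: fps_ext => n; rewrite /fps_theta /fps_dil mulrnAr. Qed.

Fact fps_dil_is_additive x : zmod_morphism (fps_dil x).
Proof. by move=> F G; apply: fps_ext => n; rewrite /fps_dil !fpsB mulrBr. Qed.
Fact fps_dil_is_multiplicative x : monoid_morphism (fps_dil x).
Proof.
split.
  apply: fps_ext => n; rewrite /fps_dil fps1.
  by case: n => [|n]; rewrite ?mulr0 // expr0 mulr1.
move=> F G; apply: fps_ext => n; rewrite /fps_dil !fpsM big_distrr /=.
apply: eq_bigr => i _; rewrite mulrACA -exprD subnKC // -ltnS.
exact: ltn_ord.
Qed.
HB.instance Definition _ x :=
  GRing.isZmodMorphism.Build (fps R) (fps R) (fps_dil x) (fps_dil_is_additive x).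
HB.instance Definition _ x :=
  GRing.isMonoidMorphism.Build (fps R) (fps R) (fps_dil x)
    (fps_dil_is_multiplicative x).

Lemma fps_substXM d F G : (0 < d)%N ->
  fps_substX d (F * G) = fps_substX d F * fps_substX d G :> fps R.
Proof.
move=> d0; apply: fps_ext => n; rewrite [RHS](fps_mul_trunc _ _ (ltnSn n)).
transitivity (((fps_trunc n.+1 F \Po 'X^d) * (fps_trunc n.+1 G \Po 'X^d))`_n).
  rewrite -comp_polyM coef_comp_poly_Xn // /fps_substX; case: ifP => // dn.
  by rewrite [LHS](@fps_mul_trunc _ n.+1) // ltnS leq_div.
have E (H : fps R) i : (i <= n)%N ->
    (fps_trunc n.+1 H \Po 'X^d)`_i = (fps_trunc n.+1 (fps_substX d H))`_i.
  move=> ni; rewrite coef_comp_poly_Xn // !coef_poly !ltnS ni /fps_substX.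
  by case: ifP => // _; rewrite (leq_trans (leq_div _ _) ni).
by apply: coefM_eq => i; apply: E.
Qed.

Lemma fps_substXB d F G :
  fps_substX d (F - G) = fps_substX d F - fps_substX d G :> fps R.
Proof.
apply: fps_ext => n; rewrite /fps_substX !fpsB.
by case: ifP => //; rewrite subr0.
Qed.

Lemma fps_substX_monom d (c : R) k : (0 < d)%N ->
  fps_substX d (fps_monom c k) = fps_monom c (k * d).
Proof.
move=> d0; apply: fps_ext => n; rewrite /fps_substX /fps_monom.
case: (boolP (d %| n)%N) => [/dvdnP[m ->]|dn];
  first by rewrite mulnK // eqn_pmul2r.
by case: eqP => // nk; rewrite nk dvdn_mull in dn.
Qed.

Lemma fps_substX1 d : (0 < d)%N -> fps_substX d 1 = 1 :> fps R.
Proof.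
move=> d0; have -> : 1 = fps_monom 1 0 :> fps R.
  by apply: fps_ext => n; rewrite fps1 /fps_monom; case: eqP.
by rewrite fps_substX_monom // mul0n.
Qed.

Lemma fps_theta_substX d F : (0 < d)%N ->
  fps_theta (fps_substX d F) = fps_substX d (fps_theta F) *+ d.
Proof.
move=> d0; apply: fps_ext => n; rewrite fpsMn /fps_theta /fps_substX.
by case: ifP => [dn|_]; rewrite ?mul0rn // -mulrnA divnK.
Qed.

(* s = z F'(z) / F(z) *)
Definition dlog F (s : fps R) : Prop := fps_theta F = F * s.

Lemma dlog_ex F : F 0 = 1 -> exists s, dlog F s.
Proof. by move=> F0; have [s sE] := fps_div_ex (fps_theta F) F0; exists s. Qed.

Lemma dlog_uniq F s t : F 0 = 1 -> dlog F s -> dlog F t -> s = t.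
Proof. by move=> F0 Fs Ft; apply: (fps_mulI F0); rewrite -Fs -Ft. Qed.

Lemma dlogM F G s t : dlog F s -> dlog G t -> dlog (F * G) (s + t).
Proof. by rewrite /dlog fps_thetaM => -> ->; ring. Qed.

Lemma dlog1 : dlog 1 0.
Proof.
apply: fps_ext => n; rewrite mulr0 /fps_theta fps1.
by case: n => [|n]; rewrite ?mulr0n ?mul0rn.
Qed.

Lemma dlogV F G s : F 0 = 1 -> F * G = 1 -> dlog F s -> dlog G (- s).
Proof.
move=> F0 FG Fs; apply: (fps_mulI F0).
have := dlog1; rewrite /dlog -FG fps_thetaM Fs mulr0 => /eqP.
rewrite addrC addr_eq0 => /eqP->; ring.
Qed.

Lemma dlog_prod I (r : seq I) (P : pred I) (F s : I -> fps R) :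
  (forall i, P i -> dlog (F i) (s i)) ->
  dlog (\prod_(i <- r | P i) F i) (\sum_(i <- r | P i) s i).
Proof.
move=> Fs; elim/big_rec2: _ => [|i G t Pi Gt]; first exact: dlog1.
by apply: dlogM => //; apply: Fs.
Qed.

Lemma dlogX F s k : dlog F s -> dlog (F ^+ k) (s *+ k).
Proof.
move=> Fs; elim: k => [|k IHk]; first exact: dlog1.
by rewrite exprS mulrS; apply: dlogM.
Qed.

Lemma dlog_dil x F s : dlog F s -> dlog (fps_dil x F) (fps_dil x s).
Proof. by rewrite /dlog fps_theta_dil => ->; rewrite rmorphM. Qed.

Lemma dlog_substX d F s : (0 < d)%N ->
  dlog F s -> dlog (fps_substX d F) (fps_substX d s *+ d).
Proof.
by move=> d0; rewrite /dlog fps_theta_substX // => ->;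
  rewrite fps_substXM // mulrnAr.
Qed.

Lemma dlog0 F s : F 0 = 1 -> dlog F s -> s 0 = 0.
Proof.
move=> F0 /(congr1 (fun G => G 0)) /=.
by rewrite fps_theta_const0 fpsM0 F0 mul1r.
Qed.

(** Comparing coefficients in z F' = F s gives a recurrence that recovers [F] from [s] wherever
    multiplication by [n] can be cancelled. *)
Lemma dlogS F s n : F 0 = 1 -> dlog F s ->
  F n *+ n = s n + \sum_(i < n) F i.+1 * s (n - i.+1)%N.
Proof.
move=> F0 /(congr1 (fun G => G n)); rewrite /= /fps_theta fpsM => ->.
by rewrite big_ord_recl F0 mul1r subn0.
Qed.

End Operators.

(** * Series determined by their logarithmic derivatives, over torsion-free rings *)

Section Uniqueness.
Variable R : comNzRingType.
Hypothesis mulrn_inj : forall n, injective (fun x : R => x *+ n.+1).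

Lemma dlog_local (F G s t : fps R) N : F 0 = 1 -> G 0 = 1 ->
  dlog F s -> dlog G t -> (forall n, (n <= N)%N -> s n = t n) ->
  forall n, (n <= N)%N -> F n = G n.
Proof.
move=> F0 G0 Fs Gt st; elim/ltn_ind => -[|n] IHn nN; first by rewrite F0 G0.
apply: (mulrn_inj (n := n)); rewrite (dlogS _ F0 Fs) (dlogS _ G0 Gt) st //.
congr (_ + _);
  rewrite !big_ord_recr /= subnn (dlog0 F0 Fs) (dlog0 G0 Gt) !mulr0.
by congr (_ + _); apply: eq_bigr => i _; rewrite IHn ?st //; case: i => /= i;
  lia.
Qed.

Lemma dlog_inj (F G s : fps R) : F 0 = 1 -> G 0 = 1 ->
  dlog F s -> dlog G s -> F = G.
Proof.
move=> F0 G0 Fs Gs; apply: fps_ext => n.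
exact: (dlog_local F0 G0 Fs Gs (N := n)).
Qed.

(** In the first degree where the series may differ, the logarithmic derivatives differ by a
    multiple of that degree; this is the source of the exact divisions in [pleth_exists]. *)
Lemma dlog_next (F G s t : fps R) n : F 0 = 1 -> G 0 = 1 ->
  dlog F s -> dlog G t -> (forall i, (i <= n)%N -> s i = t i) ->
  s n.+1 = t n.+1 + (F n.+1 - G n.+1) *+ n.+1.
Proof.
move=> F0 G0 Fs Gt st; have FG := dlog_local F0 G0 Fs Gt st.
rewrite mulrnBl (dlogS _ F0 Fs) (dlogS _ G0 Gt).
rewrite !big_ord_recr /= subnn (dlog0 F0 Fs) (dlog0 G0 Gt) !mulr0.
rewrite (eq_bigr (fun i : 'I_n => G i.+1 * t (n.+1 - i.+1)%N)); first by ring.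
by move=> i _; rewrite FG ?st //; case: i => /= i; lia.
Qed.

End Uniqueness.

Section Map.
Variables (R S : comNzRingType) (phi : {rmorphism R -> S}).

Definition fps_map (F : fps R) : fps S := fun n => phi (F n).

Lemma fps_mapM F G : fps_map (F * G) = fps_map F * fps_map G.
Proof.
apply: fps_ext => n; rewrite /fps_map !fpsM rmorph_sum.
by apply: eq_bigr => i _; rewrite rmorphM.
Qed.

Lemma dlog_map F s : dlog F s -> dlog (fps_map F) (fps_map s).
Proof.
rewrite /dlog -fps_mapM => <-; apply: fps_ext => n.
by rewrite /fps_map /fps_theta rmorphMn.
Qed.

End Map.

Section MapMore.
Variables (R S : comNzRingType) (phi : {rmorphism R -> S}).
Local Notation fmap := (fps_map phi).

Lemma fps_mapB F G : fmap (F - G) = fmap F - fmap G.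
Proof. by apply: fps_ext => n; apply: rmorphB. Qed.

Lemma fps_map1 : fmap 1 = 1.
Proof. by apply: fps_ext => n; apply: rmorph_nat. Qed.

Lemma fps_map_dil x F : fmap (fps_dil x F) = fps_dil (phi x) (fmap F).
Proof. by apply: fps_ext => n; rewrite /fps_dil /fps_map rmorphM rmorphXn. Qed.

Lemma fps_map_monom c k : fmap (fps_monom c k) = fps_monom (phi c) k.
Proof.
by apply: fps_ext => n; rewrite /fps_map /fps_monom; case: eqP;
  rewrite ?rmorph0.
Qed.

End MapMore.

(** * The Rogers-Ramanujan continued fraction *)

Section ContinuedFraction.
Variable R : comNzRingType.
Implicit Types F : fps R.

Definition rrcf (x : R) F : Prop := F = 1 - fps_monom x 1 * (F * fps_dil x F).

Lemma rrcf_contr x (F G : fps R) n : (forall i, (i < n)%N -> F i = G i) ->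
  (1 - fps_monom x 1 * (F * fps_dil x F)) n =
  (1 - fps_monom x 1 * (G * fps_dil x G)) n.
Proof.
move=> FG; rewrite !fpsB; congr (_ - _).
apply: fpsM_eqr => // i ni; apply: fpsM_eq => j ji.
  by apply: FG; lia.
by rewrite /fps_dil FG //; lia.
Qed.

Lemma rrcf_ex x : exists F, rrcf x F.
Proof. exact: fps_fix (rrcf_contr x) 0. Qed.

Lemma rrcf_uniq x F G : rrcf x F -> rrcf x G -> F = G.
Proof. by move=> FE GE; apply: (fps_fix_uniq (rrcf_contr x) FE GE). Qed.

Lemma rrcf0 x F : rrcf x F -> F 0 = 1.
Proof. by move->; rewrite fpsB fpsM0 /fps_monom /= mul0r subr0. Qed.

(* The recurrence is that of the Rogers-Ramanujan function
   F(z) = \sum_n x^(n^2) z^n / (x; x)_n. *)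
Lemma rrcf_ratio x F G : F 0 = 1 ->
  F = fps_dil x F + fps_monom x 1 * fps_dil (x * x) F ->
  rrcf x G -> fps_dil x F = F * G.
Proof.
move=> F0 FE Gx; have [H FH] := fps_div_ex (fps_dil x F) F0.
suff Hx : rrcf x H by rewrite -FH (rrcf_uniq Hx Gx).
(* Multiplied by F, the equation for H becomes the recurrence of F, because F(z) H(z) H(x z) = F(x^2
   z). *)
apply: (fps_mulI F0); have := congr1 (fps_dil x) FH.
rewrite rmorphM /= fps_dil_dil -FH => FxH.
rewrite [RHS](_ : _ = F - fps_monom x 1 * (F * H * fps_dil x H)); last by ring.
by rewrite FxH {2}FE FH addrK.
Qed.

End ContinuedFraction.

Lemma rrcf_map (R S : comNzRingType) (phi : {rmorphism R -> S}) x F :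
  rrcf x F -> rrcf (phi x) (fps_map phi F).
Proof.
rewrite /rrcf => {1}->; rewrite fps_mapB fps_map1 !fps_mapM fps_map_monom.
by rewrite fps_map_dil.
Qed.

(** * Exponents of the product expansion *)

Definition ev (K : comNzRingType) (a : K) : {rmorphism {poly int} -> K} :=
  horner_eval a \o map_poly intr.

Lemma evX (K : comNzRingType) (a : K) : ev a 'X = a.
Proof. by rewrite /= map_polyX horner_evalE hornerX. Qed.

Lemma ev_compXn (K : comNzRingType) (a : K) (g : {poly int}) k :
  ev a (g \Po 'X^k) = ev (a ^+ k) g.
Proof.
by rewrite /= map_comp_poly map_polyXn !horner_evalE horner_comp hornerXn.
Qed.

(* The logarithmic derivative of the plethystic exponential of g(x) z^l, that
   is, of \prod_j (1 - x^j z^l)^(- g_j). *)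
Definition pleth l (g : {poly int}) : fps {poly int} :=
  fun n => if (0 < n)%N && (l %| n)%N then (g \Po 'X^(n %/ l)) *+ l else 0.

Definition has_dlog (R : comNzRingType) (t : fps R) : Prop :=
  exists2 F : fps R, F 0 = 1 & dlog F t.

Section HasDlog.
Variable R : comNzRingType.
Implicit Types t u : fps R.

Lemma has_dlog0 : has_dlog (0 : fps R).
Proof. by exists 1; last exact: dlog1. Qed.

Lemma has_dlogD t u : has_dlog t -> has_dlog u -> has_dlog (t + u).
Proof.
move=> [F F0 Ft] [G G0 Gu]; exists (F * G); last exact: dlogM.
by rewrite fpsM0 F0 G0 mulr1.
Qed.

Lemma has_dlogN t : has_dlog t -> has_dlog (- t).
Proof.
move=> [F F0 Ft]; have [G FG] := fps_div_ex 1 F0.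
exists G; last exact: (dlogV F0).
by have := congr1 (fun H => H 0) FG; rewrite /= fpsM0 F0 mul1r.
Qed.

Lemma has_dlogMz t (c : int) : has_dlog t -> has_dlog (t *~ c).
Proof.
move=> tF; have tn k : has_dlog (t *+ k).
  by elim: k => [|k IHk]; rewrite ?mulrS; [apply: has_dlog0 | apply: has_dlogD].
by case: c => k; [exact: tn | exact: has_dlogN (tn k.+1)].
Qed.

Lemma has_dlog_sum I (r : seq I) (P : pred I) (E : I -> fps R) :
  (forall i, P i -> has_dlog (E i)) -> has_dlog (\sum_(i <- r | P i) E i).
Proof. by move=> EP; apply: big_ind => //; [apply: has_dlog0 | apply: has_dlogD]. Qed.

(* The logarithmic derivative of 1 / (1 - y z^l). *)
Definition geom_dlog (y : R) l : fps R :=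
  fun n => if (0 < n)%N && (l %| n)%N then y ^+ (n %/ l) *+ l else 0.

Lemma has_dlog_geom (y : R) l : (0 < l)%N -> has_dlog (geom_dlog y l).
Proof.
move=> l0; rewrite -(@opprK (fps R) (geom_dlog y l)); apply: has_dlogN.
exists (1 - fps_monom y l).
  by rewrite fpsB /fps_monom (ltn_eqF l0) subr0.
apply: fps_ext => n; rewrite mulrN mulrBl mul1r fpsN fpsB fps_monomM.
rewrite /fps_theta fpsB fps1 /fps_monom mulrnBl /geom_dlog.
have -> : (n == 0%N)%:R *+ n = 0 :> R by case: n => [|n];
  rewrite ?mulr0n ?mul0rn.
case: (eqVneq n l) => [->|nl].
  by rewrite l0 dvdnn leqnn divnn l0 subnn mulr0 subr0 sub0r.
rewrite mul0rn subr0; case: (leqP l n) => ln; last first.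
  by rewrite subr0; case: ifP => [/andP[n0 /(dvdn_leq n0)]|];
    [lia | rewrite oppr0].
have [-> ->] : (0 < n - l)%N /\ (0 < n)%N by lia.
have -> : (l %| n - l)%N = (l %| n)%N by rewrite -[in RHS](subnK ln) dvdn_addl.
case: ifP => //= [ldn|]; last by rewrite mulr0 subr0 oppr0.
have -> : (n %/ l = ((n - l) %/ l).+1)%N.
  by rewrite -[in LHS](subnK ln) divnDr // divnn l0 addn1.
by rewrite exprS mulrnAr subrr oppr0.
Qed.

End HasDlog.

(** Expanding [g] into monomials gives a product of integer powers of the 1 - x^j z^l, which stays
    within series over Z[x]. *)
Lemma has_dlog_pleth l g : (0 < l)%N -> has_dlog (pleth l g).
Proof.
move=> l0.
have -> : pleth l g = \sum_(i < size g) geom_dlog 'X^i l *~ g`_i.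
  apply: fps_ext => n; rewrite fps_sum /pleth.
  transitivity (\sum_(i < size g) geom_dlog ('X^i : {poly int}) l n *~ g`_i).
    rewrite /geom_dlog; case: ifP => _; last first.
      by rewrite big1 // => i _; rewrite mul0rz.
    rewrite -[in LHS](coefK g) poly_def raddf_sum /= -sumrMnl.
    apply: eq_bigr => i _.
    by rewrite comp_polyZ comp_Xn_poly -!exprM mulnC -{1}[g`_i]intz scaler_int !(pmulrn _ l) mulrzAC.
  apply: eq_bigr => i _.
  by case: (g`_i) => k; rewrite ?NegzE ?mulrNz ?fpsN -!pmulrn fpsMn.
by apply: has_dlog_sum => i _; apply/has_dlogMz/has_dlog_geom.
Qed.

Lemma pleth_gt l g n : (n < l)%N -> pleth l g n = 0.
Proof.
rewrite /pleth => nl; case: ifP => // /andP[n0 /(dvdn_leq n0)]; lia.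
Qed.

Lemma poly_int_mulrn_inj n : injective (fun g : {poly int} => g *+ n.+1).
Proof.
move=> g h /= /polyP gh; apply/polyP => i; have := gh i.
by rewrite !coefMn => /eqP; rewrite eqr_pMn2r // => /eqP.
Qed.

(** The w_n are found one at a time: once the factors with l <= n match F up to degree n, the
    discrepancy of [s] in degree n + 1 is n + 1 times an element of Z[x], which is w_(n+1). *)
Lemma pleth_exists (F s : fps {poly int}) : F 0 = 1 -> dlog F s ->
  exists w : fps {poly int},
    forall n, (0 < n)%N -> s n = \sum_(1 <= l < n.+1) pleth l (w l) n.
Proof.
move=> F0 Fs.
(* Coefficientwise Euclidean division by [n]; its exactness is what the end of the proof checks. *)
pose Psi (w : fps {poly int}) : fps {poly int} := fun n =>
  map_poly (fun c : int => (c %/ n)%Z) (s n - \sum_(1 <= l < n) pleth l (w l) n).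
have [|w wE] := @fps_fix _ Psi _ 0.
  move=> w v n wv; rewrite /Psi; congr (map_poly _ (_ - _)).
  by apply: eq_big_nat => l /andP[_ ln]; rewrite wv.
exists w => n; elim/ltn_ind: n => -[//|n] IHn _.
have [|G G0 Gt] := @has_dlog_sum _ _ (index_iota 1 n.+1) predT
    (fun l => if l is 0 then 0 else pleth l (w l)).
  by case=> [|l] _; [apply: has_dlog0 | apply: has_dlog_pleth].
have tE k : (\sum_(1 <= l < n.+1) (if l is 0 then 0 else pleth l (w l))) k =
    \sum_(1 <= l < n.+1) pleth l (w l) k.
  by rewrite fps_sum; apply: eq_big_nat => -[].
have st i : (i <= n)%N ->
    s i = (\sum_(1 <= l < n.+1) (if l is 0 then 0 else pleth l (w l))) i.
  rewrite tE; case: i => [_|i ni].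
    by rewrite (dlog0 F0 Fs) big1 // => l _; rewrite /pleth.
  rewrite IHn // [RHS](big_cat_nat (n := i.+2)) //= [X in _ + X]big_nat_cond.
  by rewrite [X in _ + X]big1 ?addr0 // => l /andP[/andP[il _] _];
    rewrite pleth_gt.
(* [G] collects the factors with l <= n, so the next exponent is F_(n+1) - G_(n+1). *)
have := dlog_next poly_int_mulrn_inj F0 G0 Fs Gt st; rewrite tE => sE.
rewrite sE [RHS]big_nat_recr //=; congr (_ + _).
rewrite /pleth /= dvdnn divnn /= comp_polyXr; congr (_ *+ _).
rewrite {1}wE /Psi sE [_ + _ - _]addrC addKr; apply/polyP => i.
by rewrite coef_map_id0 ?div0z // coefMn -mulr_natr natz mulzK.
Qed.

(** * The continued fraction at a root of unity *)

Section RootOfUnity.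
Variables (K : numFieldType) (e : nat) (zeta : K).
Hypothesis zeta_prim : e.-primitive_root zeta.

Let t i : fps K := fps_monom (zeta ^+ i.+1) 1.

(** With r_i(z) = F(zeta^i z), the continued fraction reads r_i (1 + t_i r_(i+1)) = 1: r_i times
    this matrix sends the column (1, r_(i+1)) to (1, r_i). *)
Definition transfer_mx i : 'M[fps K]_2 :=
  \matrix_(r, s) if r == 0 then (if s == 0 then 1 else t i) else (s == 0)%:R.

Definition transfer_prod k i := \prod_(j < k) transfer_mx (i + j).

Let P := transfer_prod.

Lemma transfer_prodS k i : P k.+1 i = transfer_mx i *m P k i.+1.
Proof.
rewrite /P /transfer_prod big_ord_recl addn0 -[_ *m _]/(_ * _); congr (_ * _).
by apply: eq_bigr => j _; rewrite lift0 addSnnS.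
Qed.

Lemma transfer_prodSr k i : P k.+1 i = P k i *m transfer_mx (i + k).
Proof. by rewrite /P /transfer_prod big_ord_recr. Qed.

Lemma mulmx2E (A B : 'M[fps K]_2) r s :
  (A *m B) r s = A r 0 * B 0 s + A r 1 * B 1 s.
Proof.
rewrite mxE !big_ord_recl big_ord0 addr0; congr (_ * _ + _ * _).
  by congr (A r _); apply: val_inj.
by congr (B _ s); apply: val_inj.
Qed.

Lemma transfer_prodE k i :
  [/\ P k.+1 i 0 0 = P k i.+1 0 0 + t i * P k i.+1 1 0,
      P k.+1 i 0 1 = P k i.+1 0 1 + t i * P k i.+1 1 1,
      P k.+1 i 1 0 = P k i.+1 0 0 & P k.+1 i 1 1 = P k i.+1 0 1].
Proof. by rewrite !transfer_prodS !mulmx2E !mxE /= !mul1r !mul0r !addr0. Qed.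

(** A crude bound by induction on the number of factors. For [e] factors the diagonal entries, hence
    the trace, have degree less than [e]. *)
Lemma transfer_prod_deg k i n :
  [/\ ((k < n)%N -> P k.+1 i 0 0 n = 0), ((k.+1 < n)%N -> P k.+1 i 0 1 n = 0),
      ((k < n)%N -> P k.+1 i 1 0 n = 0) & ((k < n)%N -> P k.+1 i 1 1 n = 0)].
Proof.
elim: k i n => [|k IHk] i n.
  have [-> -> -> ->] := transfer_prodE 0 i.
  rewrite /P /transfer_prod big_ord0 !mxE /= mulr0 mulr1 addr0 add0r.
  split => //; rewrite ?fps1; try by case: n.
  by rewrite /t /fps_monom; case: n => [|[]].
have [-> -> -> ->] := transfer_prodE k.+1 i.
have [a0 b0 c0 d0] := IHk i.+1 n.
have [_ _ c1 d1] := IHk i.+1 n.-1.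
split=> kn.
- by rewrite fpsD a0 ?fps_monomM; last lia;
    rewrite subn1 c1 ?mulr0 ?if_same ?addr0; last lia.
- by rewrite fpsD b0 ?fps_monomM; last lia;
    rewrite subn1 d1 ?mulr0 ?if_same ?addr0; last lia.
- by rewrite a0; last lia.
- by rewrite b0; last lia.
Qed.

Lemma transfer_prod_const k i :
  [/\ P k.+1 i 0 0 0%N = 1, P k.+1 i 0 1 0%N = 0, P k.+1 i 1 0 0%N = 1
    & P k.+1 i 1 1 0%N = 0].
Proof.
elim: k i => [|k IHk] i.
  have [-> -> -> ->] := transfer_prodE 0 i.
  by rewrite /P /transfer_prod big_ord0 !mxE /= mulr0 mulr1 addr0 add0r.
have [-> -> -> ->] := transfer_prodE k.+1 i.
have [a0 b0 c0 d0] := IHk i.+1.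
by rewrite !fpsD !fps_monomM /= a0 b0 !addr0.
Qed.

Lemma transfer_prod_dil k i : map_mx (fps_dil zeta) (P k i) = P k i.+1.
Proof.
elim: k i => [|k IHk] i.
  rewrite /P /transfer_prod !big_ord0; apply/matrixP => r s.
  by rewrite !mxE rmorph_nat.
rewrite !transfer_prodS map_mxM IHk; congr (_ *m _); apply/matrixP => r s.
rewrite !mxE; case: ifP => _; last by rewrite rmorph_nat.
case: ifP => _; first by rewrite rmorph1.
by rewrite /t [LHS]fps_dil_monom expr1 -exprS.
Qed.

(* A dilation permutes the factors of the product cyclically: the trace is
   invariant, hence a polynomial in z^e, and it has degree less than e. *)
Lemma transfer_prod_trace : \tr (P e 0) = 1.
Proof.
have e0 := prim_order_gt0 zeta_prim.
have [k eE] : exists k, e = k.+1 by exists e.-1; lia.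
have trE (A : 'M[fps K]_2) : \tr A = A 0 0 + A 1 1.
  rewrite /mxtrace !big_ord_recl big_ord0 addr0; congr (_ + A _ _);
  exact: val_inj.
have dil_tr : fps_dil zeta (\tr (P e 0)) = \tr (P e 0).
  have -> : fps_dil zeta (\tr (P e 0)) = \tr (P e 1).
    by rewrite -transfer_prod_dil !trE !mxE rmorphD.
  (* The last factor moves to the front under the trace; it has index [e] and equals the factor of
     index 0, since zeta^e = 1. *)
  rewrite {1}eE transfer_prodSr mxtrace_mulC eE transfer_prodS;
    congr (\tr (_ *m _)).
  by apply/matrixP => r s;
    rewrite !mxE /t add1n -eE exprS prim_expr_order ?mulr1 ?expr1.
apply: fps_ext => n; rewrite fps1.
case: (posnP n) => [->|n0].
  by rewrite trE eE fpsD; have [-> _ _ ->] := transfer_prod_const k 0;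
    rewrite addr0.
case: (ltnP n e) => ne; last first.
  rewrite trE eE fpsD; have [a0 _ _ d0] := transfer_prod_deg k 0 n.
  by rewrite a0 ?d0 ?addr0 //; lia.
(* For 0 < n < e, invariance gives (zeta^n - 1) c = 0 with zeta^n different from 1. *)
have /(congr1 (fun F => F n)) /= /eqP := dil_tr.
set c := (\tr (P e 0)) n.
rewrite /fps_dil -subr_eq0 -[X in _ - X]mul1r -mulrBl mulf_eq0 subr_eq0.
rewrite -(prim_order_dvd zeta_prim) gtnNdvd //=.
by move/eqP.
Qed.

(** Each factor has determinant - t_i, so the determinant is a constant times z^e, and the constant
    is the product of the - zeta^(j+1). *)
Lemma transfer_prod_det : P e 0 0 0 * P e 0 1 1 - P e 0 0 1 * P e 0 1 0 = - fps_monom 1 e.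
Proof.
have detE k i : P k i 0 0 * P k i 1 1 - P k i 0 1 * P k i 1 0 = \prod_(j < k) - t (i + j).
  elim: k i => [|k IHk] i.
    by rewrite /P /transfer_prod !big_ord0 !mxE /= mulr1 mulr0 subr0.
  rewrite big_ord_recl addn0 (eq_bigr (fun j : 'I_k => - t (i.+1 + j))) => [|j _].
    by rewrite -IHk; have [-> -> -> ->] := transfer_prodE k i; ring.
  by rewrite lift0 addSnnS.
rewrite detE.
have -> : \prod_(j < e) - t (0 + j) = fps_monom (\prod_(j < e) - zeta ^+ j.+1) e.
  elim: (e) => [|k IHk].
    by rewrite !big_ord0; apply: fps_ext => n; rewrite fps1 /fps_monom;
      case: eqP.
  rewrite !big_ord_recr /= IHk -[- t _]/(- fps_monom _ _).
  have -> (c : K) : - fps_monom c 1 = fps_monom (- c) 1.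
    by apply: fps_ext => n; rewrite fpsN /fps_monom; case: eqP; rewrite ?oppr0.
  by rewrite fps_monomMmonom addn1.
suff -> : \prod_(j < e) - zeta ^+ j.+1 = -1.
  by apply: fps_ext => n; rewrite fpsN /fps_monom; case: eqP; rewrite ?oppr0.
(* Evaluating X^e - 1 = prod (X - zeta^i) at 0 gives the product over the exponents 0 to e - 1;
   shifting them by one changes nothing, as zeta^e = zeta^0. *)
have := congr1 (horner^~ 0) (factor_Xn_sub_1 zeta_prim).
rewrite horner_prod !hornerE /= expr0n gtn_eqF ?(prim_order_gt0 zeta_prim) //.
rewrite sub0r => <-; rewrite big_mkord;
  under [RHS]eq_bigr do rewrite hornerXsubC sub0r.
case: (e) (prim_expr_order zeta_prim) (prim_order_gt0 zeta_prim) => // k zk _.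
by rewrite [RHS]big_ord_recl big_ord_recr /= zk expr0 mulrC.
Qed.

Lemma quadratic_contr (F G : fps K) n : (forall i, (i < n)%N -> F i = G i) ->
  (1 - fps_monom 1 e * (F * F)) n = (1 - fps_monom 1 e * (G * G)) n.
Proof.
move=> FG; rewrite !fpsB; congr (_ - _); apply: fpsM_eqr => [|i ni].
  by rewrite /fps_monom ltn_eqF ?(prim_order_gt0 zeta_prim).
by apply: fpsM_eq => j ji; apply: FG; lia.
Qed.

(** After a full cycle, (1, F) is an eigenvector of the product of the [e] transfer matrices, with
    eigenvalue 1/p for p the product of the dilates. Trace 1 and determinant - z^e turn the
    characteristic equation into p = 1 - z^e p^2, which G(z^e) satisfies too. *)
Lemma rrcf_root_of_unity (F G : fps K) : rrcf zeta F -> rrcf 1 G ->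
  \prod_(i < e) fps_dil (zeta ^+ i) F = fps_substX e G.
Proof.
move=> Fz G1; have e0 := prim_order_gt0 zeta_prim.
pose r i := fps_dil (zeta ^+ i) F.
have rE i : r i * (1 + t i * r i.+1) = 1.
  rewrite mulrDr mulr1 {1}/r {1}Fz rmorphB rmorph1 !rmorphM /= fps_dil_dil.
  by rewrite fps_dil_monom expr1 -exprSr -/(r i) -/(r i.+1) -/(t i); ring.
(* The relations telescope: the product of the r_j times [P k i] sends (1, r_(i+k)) to (1, r_i). *)
have vec k i : \prod_(j < k) r (i + j)%N * (P k i 0 0 + P k i 0 1 * r (i + k)%N) = 1 /\
    \prod_(j < k) r (i + j)%N * (P k i 1 0 + P k i 1 1 * r (i + k)%N) = r i.
  elim: k i => [|k IHk] i.
    rewrite /P /transfer_prod !big_ord0 !mxE /= addn0; split; ring.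
  rewrite big_ord_recl addn0 (eq_bigr (fun j : 'I_k => r (i.+1 + j)%N));
    last first.
    by move=> j _; rewrite lift0 addSnnS.
  have [-> -> -> ->] := transfer_prodE k i; have [] := IHk i.+1;
    rewrite addSnnS.
  set p := \prod_(j < k) _; set a := P k _ 0 0; set b := P k _ 0 1.
  set c := P k _ 1 0; set d := P k _ 1 1; move: (r (i + _)%N) => x ab cd; split.
    rewrite -[RHS](rE i) -cd -[in RHS]ab; ring.
  by rewrite -[RHS]mulr1 -ab; ring.
have [] := vec e 0; rewrite !add0n.
have -> : r e = F by rewrite /r prim_expr_order // fps_dil_id.
have -> : r 0 = F by rewrite /r expr0 fps_dil_id.
rewrite (eq_bigr (fun i : 'I_e => fps_dil (zeta ^+ i) F)) //.
have := transfer_prod_det.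
have := transfer_prod_trace; rewrite /mxtrace !big_ord_recl big_ord0 addr0.
rewrite (_ : lift ord0 ord0 = 1); last exact: val_inj.
set p := \prod_(i < e) _; set a := P e _ 0 0; set b := P e _ 0 1.
set c := P e _ 1 0; set d := P e _ 1 1 => ad det pa pc.
apply: (fps_fix_uniq quadratic_contr); last first.
  have := congr1 (fps_substX e) G1;
    rewrite fps_dil_id fps_substXB fps_substX1 //.
  by rewrite !fps_substXM // fps_substX_monom // mul1n.
have pl : p * (a + b * F) = 1 := pa.
have cF : c + d * F = (a + b * F) * F.
  by rewrite -[LHS]mul1r -pl mulrAC pc mulrC.
(* The characteristic equation for the eigenvalue a + b F. *)
have quad : (a + b * F) ^+ 2 - (a + b * F) - fps_monom 1 e = 0.
  rewrite -[X in _ - X - _]mulr1 -ad -det.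
  transitivity (b * ((a + b * F) * F - (c + d * F))); first by ring.
  by rewrite cF subrr mulr0.
change (p = 1 - fps_monom 1 e * (p * p)).
have -> : fps_monom 1 e = (a + b * F) ^+ 2 - (a + b * F).
  by apply/eqP; rewrite eq_sym -subr_eq0 quad.
transitivity (1 - (p * (a + b * F)) ^+ 2 + p * (p * (a + b * F))); last by ring.
by rewrite pl mulr1 expr1n subrr add0r.
Qed.

(** When e divides n, each of the [e] dilates contributes the same [s n], because (zeta^i)^n = 1;
    the other side is e times the coefficient of [u] at n/e. *)
Lemma dlog_root_of_unity (F G s u : fps K) n : rrcf zeta F -> rrcf 1 G ->
  dlog F s -> dlog G u -> (e %| n)%N -> s n = u (n %/ e)%N.
Proof.
move=> Fz G1 Fs Gu en; have e0 := prim_order_gt0 zeta_prim.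
have := rrcf_root_of_unity Fz G1.
have F0 := rrcf0 Fz; have G0 := rrcf0 G1.
have Ps := @dlog_prod _ _ (index_enum 'I_e) predT _ _
  (fun i _ => dlog_dil (zeta ^+ i) Fs) => PE.
have := dlog_substX e0 Gu; rewrite -PE => Pu.
have P0 : (\prod_(i < e) fps_dil (zeta ^+ i) F) 0%N = 1.
  by rewrite PE /fps_substX dvdn0 div0n.
have := congr1 (fun H => H n) (dlog_uniq P0 Ps Pu).
rewrite /= fps_sum fpsMn /fps_substX en (eq_bigr (fun=> s n)) => [|i _].
  rewrite sumr_const card_ord => /eqP; rewrite eqr_pMn2r //; first by move/eqP.
have /eqP zn : zeta ^+ n == 1 by rewrite -(prim_order_dvd zeta_prim).
by rewrite /fps_dil exprAC zn expr1n mul1r.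
Qed.

End RootOfUnity.

(** * Vanishing of the exponents at roots of unity *)

Section RootsOfExponents.
Variables (F s w : fps {poly int}).
Hypotheses (FX : rrcf 'X F) (Fs : dlog F s).
Hypothesis sw : forall n, (0 < n)%N -> s n = \sum_(1 <= l < n.+1) pleth l (w l) n.

Lemma ev_pleth (K : comNzRingType) (a : K) l g n : (0 < n)%N ->
  ev a (pleth l g n) = if (l %| n)%N then ev (a ^+ (n %/ l)) g *+ l else 0.
Proof.
move=> n0; rewrite /pleth n0 andTb; case: ifP => _; last by rewrite rmorph0.
by rewrite rmorphMn; congr (_ *+ _); apply: ev_compXn.
Qed.

(** Let e be the order of zeta. Then s_n(zeta) = s_(n/e)(1), and both sides expand over divisors l.
    For l < n the terms agree if e divides n/l; otherwise w_l vanishes by induction at zeta^(n/l), a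
    nontrivial l-th root of unity. What is left is n w_n(zeta) = 0. *)
Lemma rrcf_exponent_root (K : numFieldType) (zeta : K) n : (0 < n)%N ->
  zeta ^+ n = 1 -> zeta != 1 -> ev zeta (w n) = 0.
Proof.
elim/ltn_ind: n zeta => n IHn zeta n0 zn z1.
have [e e_prim en] := prim_order_exists n0 zn.
have e0 := prim_order_gt0 e_prim.
have e1 : (1 < e)%N.
  rewrite ltn_neqAle e0 andbT; apply: contraNneq z1 => e1.
  by rewrite -(prim_expr_order e_prim) -e1 expr1.
have ne0 : (0 < n %/ e)%N by rewrite divn_gt0 // dvdn_leq.
have Fz : rrcf zeta (fps_map (ev zeta) F).
  by have := rrcf_map (ev zeta) FX; rewrite evX.
have F1 : rrcf 1 (fps_map (ev (1 : K)) F).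
  by have := rrcf_map (ev (1 : K)) FX; rewrite evX.
have := dlog_root_of_unity e_prim Fz F1
  (dlog_map (ev zeta) Fs) (dlog_map (ev 1) Fs) en.
rewrite /fps_map !sw // !rmorph_sum => /eqP; rewrite -subr_eq0.
have -> : \sum_(1 <= l < (n %/ e).+1) ev 1 (pleth l (w l) (n %/ e)%N) =
    \sum_(1 <= l < n.+1) ev (1 : K) (pleth l (w l) (n %/ e)%N).
  have ne : ((n %/ e) <= n)%N by apply: leq_div.
  rewrite [RHS](big_cat_nat (n := (n %/ e).+1)) //= [X in _ + X]big_nat_cond.
  rewrite [X in _ + X]big1 ?addr0 // => l /andP[/andP[il _] _].
  by rewrite pleth_gt ?rmorph0.
rewrite -sumrB big_nat_recr // big_nat_cond big1; last first.
  move=> l /andP[/andP[l0 ln] _]; rewrite !ev_pleth // expr1n.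
  case: (boolP (l %| n)%N) => [ldn|lNdn]; last first.
    rewrite ifF ?subr0 //; apply: contraNF lNdn => /dvdn_trans; apply.
    by rewrite -{2}(divnK en) dvdn_mulr.
  have nE : n = (n %/ l * l)%N by rewrite divnK.
  have -> : (l %| n %/ e)%N = (e %| n %/ l)%N.
    by rewrite dvdn_divRL // mulnC -dvdn_divRL.
  case: ifP => enl.
    rewrite (_ : zeta ^+ _ = 1) ?subrr //.
    by apply/eqP; rewrite -(prim_order_dvd e_prim).
  rewrite subr0 IHn ?mul0rn //; first by rewrite -exprM -nE.
  by rewrite -(prim_order_dvd e_prim) enl.
(* The top term l = n occurs only on the left: n does not divide n/e, as e > 1. *)
rewrite !ev_pleth // dvdnn divnn n0 expr1 gtnNdvd // ?ltn_Pdiv // subr0.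
rewrite -[X in X == 0]/(0 + ev zeta (w n) *+ n) add0r.
by rewrite mulrn_eq0 gtn_eqF //= => /eqP.
Qed.

(** The remainder of w_n modulo the monic polynomial 1 + ... + X^(n-1) has degree less than n - 1,
    yet vanishes at the n - 1 nontrivial n-th roots of unity in [algC]. *)
Lemma rrcf_exponent_dvd : exists v : fps {poly int},
  forall n, (0 < n)%N -> w n = v n * \sum_(i < n) 'X^i.
Proof.
pose D n : {poly int} := \sum_(i < n) 'X^i.
exists (fun n => Pdiv.CommonRing.rdivp (w n) (D n)) => n n0.
have DE : D n = \poly_(i < n) 1.
  by rewrite poly_def; apply: eq_bigr => i _; rewrite scale1r.
have sD : size (D n) = n by rewrite DE size_poly_eq // oner_neq0.
have Dmonic : D n \is monic.
  by rewrite monicE lead_coefE sD DE coef_poly prednK // leqnn.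
have wE := Pdiv.RingMonic.rdivp_eq Dmonic (w n).
rewrite -/(D n) [LHS]wE; move: wE; set rem := Pdiv.CommonRing.rmodp _ _.
set quo := Pdiv.CommonRing.rdivp _ _ => wE.
suff -> : rem = 0 by rewrite addr0.
have size_rem : (size rem < n)%N.
  by rewrite -[n in (_ < n)%N]sD Pdiv.CommonRing.ltn_rmodp -size_poly_gt0 sD.
have [zeta z_prim] := C_prim_root_exists n0.
pose remC : {poly algC} := map_poly intr rem.
suff remC0 : remC = 0.
  by apply/polyP => i; apply/eqP;
    rewrite coef0 -(intr_eq0 algC) -coef_map -/remC remC0 coef0.
apply/eqP; apply: contraLR size_rem => remC0; rewrite -leqNgt.
have -> : size rem = size remC by rewrite size_map_inj_poly //; apply: intr_inj.
pose rs := [seq zeta ^+ i.+1 | i <- iota 0 n.-1].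
have <- : (size rs).+1 = n by rewrite size_map size_iota prednK.
apply: max_poly_roots => //.
  apply/allP => _ /mapP[i i_lt ->]; move: i_lt; rewrite mem_iota => /andP[_ ni].
  have zi1 : zeta ^+ i.+1 != 1.
    by rewrite -(prim_order_dvd z_prim) gtnNdvd //; lia.
  have zin : (zeta ^+ i.+1) ^+ n = 1.
    by rewrite exprAC (prim_expr_order z_prim) expr1n.
  have := rrcf_exponent_root n0 zin zi1; rewrite wE rmorphD rmorphM.
  rewrite (_ : ev _ (D n) = 0) ?mulr0 ?add0r; first by move/eqP.
  (* At a nontrivial root y, (y - 1) (1 + ... + y^(n-1)) = y^n - 1 = 0. *)
  apply: (mulfI (x := zeta ^+ i.+1 - 1)); first by rewrite subr_eq0.
  rewrite mulr0 -[_ - 1]/(_ - _) rmorph_sum /=.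
  under eq_bigr do rewrite map_polyXn horner_evalE hornerXn.
  by rewrite -subrX1 zin subrr.
rewrite map_inj_in_uniq ?iota_uniq // => i j;
  rewrite !mem_iota => /andP[_ ni] /andP[_ nj].
by move/eqP; rewrite (eq_prim_root_expr z_prim) !modn_small; lia.
Qed.

End RootsOfExponents.

(** * Exponential and logarithm *)

Section Comp.
Variable R : comNzRingType.
Implicit Types F G : fps R.

(** Writing the outer coefficients as constant series makes a composition, up to degree [N], a
    finite sum in the ring of series. *)
Lemma fps_comp_sum F G N n : G 0 = 0 -> (n <= N)%N ->
  fps_comp F G n = (\sum_(k < N.+1) fps_monom (F k) 0 * G ^+ k) n.
Proof.
move=> G0 nN; rewrite (fps_comp_wide F G0 nN) fps_sum.
by apply: eq_bigr => k _; rewrite fps_monomM subn0.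
Qed.

(** The chain rule: the [F k.+1 *+ k.+1] are the coefficients of F'. *)
Lemma fps_theta_comp F G : G 0 = 0 ->
  fps_theta (fps_comp F G) =
  fps_comp (fun k => F k.+1 *+ k.+1) G * fps_theta G.
Proof.
move=> G0; apply: fps_ext => n.
have sumE (S : fps R) : fps_theta S n = S n *+ n by [].
rewrite sumE (fps_comp_sum F G0 (leqnSn n)) -sumE.
pose D : fps R := \sum_(k < n.+1) fps_monom (F k.+1 *+ k.+1) 0 * G ^+ k.
transitivity ((D * fps_theta G) n); last first.
  by apply: fpsM_eq => // i ni; rewrite (fps_comp_sum _ G0 ni).
congr (_ n); rewrite big_distrl /= big_ord_recl /= fps_thetaD.
have theta_sum m (E : nat -> fps R) :
    fps_theta (\sum_(k < m) E k) = \sum_(k < m) fps_theta (E k).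
  elim: m => [|m IHm]; last by rewrite !big_ord_recr fps_thetaD IHm.
  by rewrite !big_ord0; apply: fps_ext => k; rewrite /fps_theta mul0rn.
have theta_const c k S : fps_theta (fps_monom c 0 * S) k = (fps_monom c 0 * fps_theta S) k.
  by rewrite /fps_theta !fps_monomM subn0 mulrnAr.
rewrite (theta_sum _ (fun k => fps_monom (F k.+1) 0 * G ^+ k.+1)).
have -> : fps_theta (fps_monom (F 0) 0 * G ^+ 0) = 0.
  apply: fps_ext => k; rewrite theta_const fps_monomM /fps_theta expr0 fps1.
  by case: k => [|k]; rewrite ?mulr0n ?mul0rn mulr0.
rewrite add0r; apply: eq_bigr => k _; apply: fps_ext => i.
rewrite theta_const fps_thetaX -mulrA !fps_monomM fpsMn /=.
by rewrite mulrnAr mulrnAl.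
Qed.

End Comp.

Lemma dlog_exp G : G 0 = 0 -> dlog (fps_exp G) (fps_theta G).
Proof.
move=> G0; rewrite /dlog fps_theta_comp //; congr (_ * _); congr (fps_comp _ _).
apply: fps_ext => k; rewrite factS natrM invfM -mulrnAl.
by rewrite -[_ *+ _]mulr_natr mulVf ?mul1r // pnatr_eq0.
Qed.

Lemma fps_comp0 (R : comNzRingType) (F G : fps R) : fps_comp F G 0 = F 0.
Proof. by rewrite /fps_comp big_ord1 mulr1. Qed.

Lemma fps_exp0 G : fps_exp G 0 = 1.
Proof. by rewrite /fps_exp fps_comp0 invr1. Qed.

(** The derivative of the logarithm series is the geometric series in - (F - 1), the inverse of
    F. *)
Lemma dlog_log (F : fps rat) : F 0 = 1 -> dlog F (fps_theta (fps_log F)).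
Proof.
move=> F0; have U0 : (F - 1) 0 = 0 by rewrite fpsB F0 subrr.
rewrite /dlog /fps_log fps_theta_comp // mulrA.
have -> : fps_theta (fps_sub F (fps_one rat)) = fps_theta F.
  apply: fps_ext => n; rewrite /fps_theta /fps_sub /fps_one.
  by case: n => // n; rewrite subr0.
suff -> : F * fps_comp (fun k => (-1) ^+ k.+2 / k.+1%:R *+ k.+1) (fps_sub F (fps_one rat)) = 1.
  by rewrite mul1r.
(* The geometric sum may be cut after exponent [n]: the defect (- (F - 1))^(n+1) has no term of
   degree [n]. *)
apply: fps_ext => n; pose S : fps rat := \sum_(k < n.+1) (- (F - 1)) ^+ k.
transitivity ((F * S) n).
  apply: fpsM_eq => // i ni; rewrite (fps_comp_sum _ (G := F - 1) U0 ni).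
  rewrite /S !fps_sum; apply: eq_bigr => k _; rewrite fps_monomM subn0.
  rewrite -mulr_natr divfK ?pnatr_eq0 // (exprNn (F - 1)).
  have -> : (-1) ^+ k = fps_monom ((-1) ^+ k) 0 :> fps rat.
    rewrite -[in LHS]signr_odd -[in RHS]signr_odd; apply: fps_ext => j;
      rewrite /fps_monom.
    by case: (odd k); rewrite ?expr1 ?expr0 ?fpsN fps1; case: eqP => //;
      rewrite oppr0.
  by rewrite fps_monomM subn0 !exprS !mulN1r opprK.
have -> : F * S = 1 - (- (F - 1)) ^+ n.+1.
  have := subrX1 (- (F - 1)) n.+1; rewrite -/S => SE.
  by rewrite -[RHS]opprB SE; ring.
by rewrite fpsB fpsX_small ?subr0 // fpsN U0 oppr0.
Qed.

(** * The coefficients of h *)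

Section Hser.
Variable Q : rat.
Hypotheses (Q0 : Q != 0) (Q1 : forall n, (0 < n)%N -> Q ^+ n != 1).

Lemma fserS n : fser Q n.+1 = - fser Q n / (Q ^+ n * (1 - Q ^+ n.+1)).
Proof.
rewrite /fser /qpoch big_nat_recr //= binS bin1 exprD exprS mulN1r -!mulNr.
by rewrite -mulf_div -!mulrA !invfM; ring.
Qed.

(** With x = 1/Q, this amounts to (1 - x^(n+1)) f_(n+1) = x^(2n+1) f_n. *)
Lemma fser_rr :
  fser Q = fps_dil Q^-1 (fser Q) + fps_monom Q^-1 1 * fps_dil (Q^-1 * Q^-1) (fser Q).
Proof.
apply: fps_ext => -[|n]; rewrite fpsD fps_monomM /= /fps_dil.
  by rewrite expr0 mul1r addr0.
rewrite subSS subn0 fserS exprMn !exprVn.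
have := Q1 (ltn0Sn n); rewrite exprS; have := expf_neq0 n Q0.
move: (Q ^+ n) => y y0 y1; field.
by rewrite Q0 y0 subr_eq0 eq_sym y1.
Qed.

End Hser.

(** Logarithmic derivatives in f(x z) = f(z) R(z) give (x^n - 1) n h_n = s_n(x). The v_l are chosen
    before Q, so the same ones serve q and q^d. *)
Lemma hser_exponents : exists v : fps {poly int}, forall Q : rat, Q != 0 ->
  (forall n, (0 < n)%N -> Q ^+ n != 1) -> forall n, (0 < n)%N ->
  hser Q n *+ n = \sum_(1 <= l < n.+1) if (l %| n)%N
    then ev (Q^-1 ^+ (n %/ l)) (v l) / (Q^-1 ^+ (n %/ l) - 1) *+ l else 0.
Proof.
have [F FX] := rrcf_ex ('X : {poly int}).
have F0 := rrcf0 FX; have [s Fs] := dlog_ex F0.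
have [w sw] := pleth_exists F0 Fs.
have [v wv] := rrcf_exponent_dvd FX Fs sw.
exists v => Q Q0 Q1 n n0; set x := Q^-1.
have f0 : fser Q 0 = 1 by rewrite /fser /qpoch big_geq // mulr1 invr1 mulr1.
have Fx : rrcf x (fps_map (ev x) F) by have := rrcf_map (ev x) FX; rewrite evX.
have fh := dlog_log f0.
have fxF := rrcf_ratio f0 (fser_rr Q0 Q1) Fx.
have := dlogM fh (dlog_map (ev x) Fs); rewrite -fxF => fh'.
have xf0 : fps_dil x (fser Q) 0 = 1 by rewrite fps_dil0.
have := congr1 (fun G => G n) (dlog_uniq xf0 (dlog_dil x fh) fh').
rewrite /= fpsD /fps_dil -/(hser Q).
have -> : fps_theta (hser Q) n = hser Q n *+ n by [].
set h := hser Q n *+ n => /eqP;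
  rewrite addrC -subr_eq -{2}[h]mul1r -mulrBl => /eqP hE.
have x1 k : (0 < k)%N -> x ^+ k - 1 != 0.
  by move=> k0; rewrite subr_eq0 exprVn invr_eq1 Q1.
apply: (mulfI (x1 _ n0)); rewrite hE /fps_map sw // rmorph_sum big_distrr /=.
apply: eq_big_nat => l /andP[l0 ln].
rewrite -[LHS]/(ev x (pleth l (w l) n)) ev_pleth //; case: ifP => ldn;
  last by rewrite mulr0.
set y := x ^+ (n %/ l); have y1 : y - 1 != 0 by rewrite x1 ?divn_gt0.
(* Here x^n = y^l, and (y^l - 1) / (y - 1) is the sum of the y^i, the cofactor of v_l(y) in
   w_l(y). *)
rewrite -[in RHS](divnK ldn) exprM -/y wv // rmorphM rmorph_sum subrX1 mulrnAr.
congr (_ *+ _); rewrite [in LHS](eq_bigr (fun i : 'I_l => y ^+ i)) => [|i _];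
  last first.
  by rewrite rmorphXn evX.
by rewrite [RHS]mulrC mulrA divfK.
Qed.

Lemma sum_dvd_widen (V : zmodType) (E : nat -> V) n N : (0 < n <= N)%N ->
  \sum_(1 <= l < N.+1) (if (l %| n)%N then E l else 0) =
  \sum_(1 <= l < n.+1) (if (l %| n)%N then E l else 0).
Proof.
move=> /andP[n0 nN];
  rewrite (big_cat_nat (n := n.+1)) //= [X in _ + X]big_nat_cond.
rewrite [X in _ + X]big1 ?addr0 // => l /andP[/andP[nl _] _].
by rewrite gtnNdvd.
Qed.

Lemma hdiff_coef (Q : rat) d n : (0 < d)%N ->
  fps_theta (fps_sub (hser Q)
    (fps_scale (1 / d%:R) (fps_substX d (hser (Q ^+ d))))) n =
  hser Q n *+ n - (if (d %| n)%N then hser (Q ^+ d) (n %/ d)%N *+ (n %/ d) else 0).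
Proof.
move=> d0; rewrite /fps_theta /fps_sub /fps_scale /fps_substX mulrnBl.
congr (_ - _); case: ifP => [dn|]; last by rewrite mulr0 mul0rn.
rewrite -{2}(divnK dn) mulnC mulrnA -[_ *+ d]mulr_natr mul1r mulrAC mulVf ?mul1r //.
by rewrite pnatr_eq0 -lt0n.
Qed.

(** In degree n, the l-th term of h(Q^d, z^d) / d involves Q^d to the power - n/(d l), that is, Q to
    the power - n/l; it cancels the l-th term of h(Q, z) whenever d divides n/l. *)
Lemma hdiff_exponents : exists v : fps {poly int}, forall (Q : rat) d, Q != 0 ->
  (forall n, (0 < n)%N -> Q ^+ n != 1) -> (0 < d)%N -> forall n, (0 < n)%N ->
  fps_theta (fps_sub (hser Q)
    (fps_scale (1 / d%:R) (fps_substX d (hser (Q ^+ d))))) n =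
  \sum_(1 <= l < n.+1) if (l %| n)%N
    then (if (d %| n %/ l)%N then 0
          else ev (Q^-1 ^+ (n %/ l)) (v l) / (Q^-1 ^+ (n %/ l) - 1)) *+ l else 0.
Proof.
have [v vE] := hser_exponents; exists v => Q d Q0 Q1 d0 n n0.
rewrite hdiff_coef // vE //.
have Qd1 k : (0 < k)%N -> (Q ^+ d) ^+ k != 1.
  by move=> k0; rewrite -exprM Q1 // muln_gt0 d0.
case: ifP => dn; last first.
  rewrite subr0; apply: eq_big_nat => l _; case: ifP => // ln; rewrite ifF //.
  by apply: contraFF dn => /dvdn_trans; apply; rewrite -{2}(divnK ln) dvdn_mulr.
have nd0 : (0 < n %/ d)%N by rewrite divn_gt0 // dvdn_leq.
rewrite vE ?expf_neq0 // -(@sum_dvd_widen _ _ (n %/ d) n) ?nd0 ?leq_div // -sumrB.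
apply: eq_big_nat => l /andP[l0 ln].
case: (boolP (l %| n)%N) => lndv; last first.
  rewrite ifF ?subr0 //; apply: contraNF lndv => /dvdn_trans; apply.
  by rewrite -{2}(divnK dn) dvdn_mulr.
have -> : (d %| n %/ l)%N = (l %| n %/ d)%N.
  by rewrite dvdn_divRL // mulnC -dvdn_divRL.
case: ifP => [lnd|_]; last by rewrite subr0.
have -> : (Q ^+ d)^-1 ^+ (n %/ d %/ l) = Q^-1 ^+ (n %/ l).
  by rewrite -exprVn -exprM muln_divA // [(d * _)%N]mulnC divnK.
by rewrite subrr mul0rn.
Qed.

(** * Rational p-adic integers *)

Section Pint.
Variables (p : nat) (p_prime : prime p).

(** The localisation of the integers at p. Any denominator prime to p serves as witness, reduced or
    not, which eases sums and products. *)
Definition pint (x : rat) : Prop :=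
  exists2 b : nat, ~~ (p %| b)%N & x * b%:R \is a Num.int.

Lemma pint_int x : x \is a Num.int -> pint x.
Proof. by exists 1%N; rewrite ?mulr1 // dvdn1 gtn_eqF ?prime_gt1. Qed.

Lemma pint0 : pint 0. Proof. exact/pint_int/rpred0. Qed.
Lemma pint1 : pint 1. Proof. exact/pint_int/rpred1. Qed.

Lemma pintD x y : pint x -> pint y -> pint (x + y).
Proof.
move=> [b pb xb] [c pc yc]; exists (b * c)%N;
  first by rewrite Euclid_dvdM // negb_or pb.
rewrite (_ : _ * _ = x * b%:R * c%:R + y * c%:R * b%:R); last by rewrite natrM;
  ring.
by rewrite rpredD // rpredM ?rpred_nat.
Qed.

Lemma pintM x y : pint x -> pint y -> pint (x * y).
Proof.
move=> [b pb xb] [c pc yc]; exists (b * c)%N;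
  first by rewrite Euclid_dvdM // negb_or pb.
by rewrite natrM mulrACA rpredM.
Qed.

Lemma pintN x : pint x -> pint (- x).
Proof. by move=> [b pb xb]; exists b; rewrite // mulNr rpredN. Qed.

Lemma pintB x y : pint x -> pint y -> pint (x - y).
Proof. by move=> px py; apply/pintD/pintN. Qed.

Lemma pint_nat n : pint n%:R. Proof. exact/pint_int/rpred_nat. Qed.
Lemma pint_intr (z : int) : pint z%:~R. Proof. exact/pint_int/intr_int. Qed.

Lemma pintX x n : pint x -> pint (x ^+ n).
Proof.
by move=> px; elim: n => [|n IHn]; rewrite ?exprS;
  [apply: pint1 | apply: pintM].
Qed.

Lemma pint_sum I (r : seq I) (P : pred I) (E : I -> rat) :
  (forall i, P i -> pint (E i)) -> pint (\sum_(i <- r | P i) E i).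
Proof. by move=> EP; apply: big_ind => //; [apply: pint0 | apply: pintD]. Qed.

Lemma pint_invn b : ~~ (p %| b)%N -> pint b%:R^-1.
Proof.
move=> pb; exists b => //; rewrite mulVf ?rpred1 // pnatr_eq0.
by apply: contraNneq pb => ->; rewrite dvdn0.
Qed.

Lemma pint_ev (g : {poly int}) y : pint y -> pint (ev y g).
Proof.
move=> py; rewrite /= horner_evalE horner_coef; apply: pint_sum => i _.
by rewrite coef_map; apply: pintM; [apply: pint_intr | apply: pintX].
Qed.

(** Each x^i - y^i is divisible by x - y, with cofactor an integral polynomial in x and y. *)
Lemma ev_sub_pint (g : {poly int}) x y : pint x -> pint y ->
  exists2 c, pint c & ev x g - ev y g = (x - y) * c.
Proof.
move=> px py.
have evE (z : rat) : ev z g = \sum_(i < size g) (g`_i)%:~R * z ^+ i.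
  rewrite /= horner_evalE horner_coef size_map_inj_poly //;
    last exact: intr_inj.
  by apply: eq_bigr => i _; rewrite coef_map.
exists (\sum_(i < size g) (g`_i)%:~R * \sum_(j < i) x ^+ (i.-1 - j) * y ^+ j).
  apply: pint_sum => i _; apply: pintM; first exact: pint_intr.
  by apply: pint_sum => j _; apply: pintM; apply: pintX.
rewrite !evE -sumrB big_distrr; apply: eq_bigr => i _.
by rewrite -mulrBr subrXX mulrCA.
Qed.

(** * Integrality of exponentials *)

Lemma pint_fpsX (F : fps rat) n k : (forall i, (i < n)%N -> pint (F i)) ->
  forall i, (i < n)%N -> pint ((F ^+ k) i).
Proof.
move=> pF; elim: k => [|k IHk] i ni.
  by rewrite expr0 fps1; apply: pint_nat.
rewrite exprS fpsM; apply: pint_sum => j _.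
by apply: pintM; [apply: pF | apply: IHk]; case: j => /= j; lia.
Qed.

(** In degree n + 1, F^b is b F_(n+1) plus an integral polynomial in the earlier coefficients, and b
    is a p-adic unit. *)
Lemma fps_root_pint (F : fps rat) b : F 0 = 1 -> ~~ (p %| b)%N ->
  (forall n, pint ((F ^+ b) n)) -> forall n, pint (F n).
Proof.
move=> F0 pb pF; elim/ltn_ind => -[|n] IHn; first by rewrite F0; apply: pint1.
have step k : pint ((F ^+ k) n.+1 - k%:R * F n.+1).
  elim: k => [|k IHk]; first by rewrite expr0 fps1 mul0r subr0; apply: pint0.
  rewrite exprS fpsM big_ord_recl big_ord_recr /= F0 subn0 subnn fpsX0 F0 expr1n.
  rewrite mul1r mulr1 -natr1.
  set S := \sum_(i < n) _.
  rewrite (_ : _ - _ = (F ^+ k) n.+1 - k%:R * F n.+1 + S).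
    apply: pintD => //; apply: pint_sum => i _; apply: pintM.
      by apply: IHn; case: i => i i_lt /=; rewrite /bump /=; lia.
    by apply: (@pint_fpsX _ n.+1) => //; case: i => i i_lt /=;
      rewrite /bump /=; lia.
  by rewrite /lift /= /bump /= add1n; ring.
have := pintB (pF n.+1) (step b); rewrite opprB addrC subrK => pbF.
rewrite -[F n.+1](mulKf (x := b%:R)); first by apply: pintM => //;
  apply: pint_invn.
by rewrite pnatr_eq0; apply: contraNneq pb => ->; rewrite dvdn0.
Qed.

Definition has_pint_dlog (t : fps rat) : Prop :=
  exists F : fps rat, [/\ F 0 = 1, dlog F t & forall n, pint (F n)].

Lemma has_pint_dlogD t u : has_pint_dlog t -> has_pint_dlog u -> has_pint_dlog (t + u).
Proof.
move=> [F [F0 Ft pF]] [G [G0 Gu pG]]; exists (F * G); split; last first.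
- by move=> n; rewrite fpsM; apply: pint_sum => i _; apply: pintM.
- exact: dlogM.
- by rewrite fpsM0 F0 G0 mulr1.
Qed.

Lemma has_pint_dlog0 : has_pint_dlog 0.
Proof.
by exists 1; split; [| exact: dlog1 | move=> n; rewrite fps1; apply: pint_nat].
Qed.

Lemma has_pint_dlog_sum I (r : seq I) (P : pred I) (E : I -> fps rat) :
  (forall i, P i -> has_pint_dlog (E i)) -> has_pint_dlog (\sum_(i <- r | P i) E i).
Proof.
by move=> EP; apply: big_ind => //;
  [apply: has_pint_dlog0 | apply: has_pint_dlogD].
Qed.

Lemma rat_mulrn_inj n : injective (fun x : rat => x *+ n.+1).
Proof. by move=> x y /= /eqP; rewrite eqr_pMn2r // => /eqP. Qed.

(* (1 - z^m)^(- c) is p-integral: a power of it with exponent prime to p has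
   integral coefficients. *)
Lemma has_pint_dlog_geom c m : (0 < m)%N -> pint c ->
  has_pint_dlog (fps_scale c (geom_dlog 1 m)).
Proof.
move=> m0 [b pb /intrP[a cb]]; set t := fps_scale _ _.
have b0 : b%:R != 0 :> rat.
  by rewrite pnatr_eq0; apply: contraNneq pb => ->; rewrite dvdn0.
(* [G] is - c log (1 - z^m); its constant term is 0 because 0^-1 = 0. *)
pose G : fps rat := fun n => t n / n%:R.
have G0 : G 0 = 0 by rewrite /G invr0 mulr0.
have Gt : fps_theta G = t.
  apply: fps_ext => -[|n]; rewrite /fps_theta /G.
    by rewrite mulr0n /t /fps_scale /geom_dlog mulr0.
  by rewrite -[LHS]mulr_natr divfK // pnatr_eq0.
have Et := dlog_exp G0; rewrite Gt in Et.
exists (fps_exp G); split; rewrite ?fps_exp0 //.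
apply: (fps_root_pint (fps_exp0 G) pb).
(* With a = b c, [F] is (1 - z^m)^(- a) over the integers; it will equal the [b]-th power of the
   exponential. *)
have [F F0 Ft] := has_dlogMz a (has_dlog_geom (1 : int) m0).
have F0' : fps_map (intr : {rmorphism int -> rat}) F 0 = 1 by rewrite /fps_map F0.
have := dlog_map (intr : {rmorphism int -> rat}) Ft.
set u := (X in dlog _ X) => Fu.
have uE : t *+ b = u.
  apply: fps_ext => n; rewrite fpsMn /t /fps_scale /u /fps_map.
  have MzE (w : fps int) : (w *~ a) n = w n *~ a.
    by case: (a) => k; rewrite ?NegzE ?mulrNz ?fpsN -!pmulrn fpsMn.
  rewrite MzE rmorphMz /= -mulr_natr mulrAC cb -[RHS]mulrzl; congr (_ * _).
  by rewrite /geom_dlog; case: ifP => // _; rewrite !expr1n rmorphMn.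
have E0 : (fps_exp G ^+ b) 0%N = 1 by rewrite fpsX0 fps_exp0 expr1n.
have Ebt := dlogX b Et; rewrite uE in Ebt.
by move=> n; rewrite (dlog_inj rat_mulrn_inj E0 F0' Ebt Fu); apply: pint_intr.
Qed.

(** Subtracting the divisor sum of a(k/p) from that of a(k) leaves the j with k/j prime to p. After
    division by k, these contribute c_j / (k/j), which is p-integral by induction for j < k; hence
    so is c_k. *)
Lemma pint_exponents (a : nat -> rat) : (forall k, pint (a k)) ->
  (forall k, (0 < k)%N -> (p %| k)%N -> pint ((a k - a (k %/ p)%N) / k%:R)) ->
  exists2 c : fps rat, forall k, (0 < k)%N -> pint (c k) &
    forall k, (0 < k)%N ->
      a k = \sum_(1 <= j < k.+1) if (j %| k)%N then c j *+ j else 0.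
Proof.
move=> pa cong.
pose Psi (c : fps rat) : fps rat := fun k =>
  (a k - \sum_(1 <= j < k) if (j %| k)%N then c j *+ j else 0) / k%:R.
have [|c cE] := @fps_fix _ Psi _ 0.
  move=> c c' k cc; rewrite /Psi; congr ((_ - _) / _).
  by apply: eq_big_nat => j /andP[_ jk]; rewrite cc.
have aE k : (0 < k)%N ->
    a k = \sum_(1 <= j < k.+1) if (j %| k)%N then c j *+ j else 0.
  move=> k0; rewrite big_nat_recr //= dvdnn -mulr_natr {2}cE /Psi divfK.
    by rewrite addrC subrK.
  by rewrite pnatr_eq0 -lt0n.
exists c => //; elim/ltn_ind => k IHk k0.
have kr0 : k%:R != 0 :> rat by rewrite pnatr_eq0 -lt0n.
have pdv j : (j %| k)%N -> (p %| k)%N -> (p %| k %/ j)%N = (j %| k %/ p)%N.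
  by move=> jk pk; rewrite dvdn_divRL // mulnC -dvdn_divRL.
(* The j with p dividing k/j are the divisors of k/p, and their terms add up to a(k/p). *)
have split_sum : \sum_(1 <= j < k) (if (j %| k)%N then c j *+ j else 0) =
    \sum_(1 <= j < k) (if (j %| k)%N && ~~ (p %| k %/ j)%N then c j *+ j else 0) +
    (if (p %| k)%N then a (k %/ p)%N else 0).
  case: ifP => pk; last first.
    rewrite addr0; apply: eq_bigr => j _; case: (boolP (j %| k)%N) => //= jk.
    rewrite ifT //; apply: contraFN pk => /dvdn_trans; apply.
    by rewrite -{2}(divnK jk) dvdn_mulr.
  have p1 := prime_gt1 p_prime.
  have kp0 : (0 < k %/ p)%N by rewrite divn_gt0 ?prime_gt0 // dvdn_leq.
  have kpk : (k %/ p <= k.-1)%N.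
    by rewrite -ltnS prednK // ltn_Pdiv.
  rewrite aE // -(@sum_dvd_widen _ _ _ k.-1) ?kp0 // prednK // -big_split /=.
  apply: eq_bigr => j _; case: (boolP (j %| k)%N) => /= jk.
    by rewrite pdv //; case: (j %| _)%N; rewrite /= ?addr0 ?add0r.
  rewrite ifF ?addr0 //; apply: contraNF jk => /dvdn_trans; apply.
  by rewrite -{2}(divnK pk) dvdn_mulr.
rewrite cE /Psi split_sum opprD addrCA addrC mulrDl; apply: pintD; last first.
  rewrite mulNr big_distrl /=; apply: pintN; rewrite big_nat_cond.
  apply: pint_sum => j /andP[/andP[j0 jk] _]; case: ifP => [/andP[jdk pkj]|_].
    have -> : c j *+ j / k%:R = c j / (k %/ j)%:R.
      have kj0 : (0 < k %/ j)%N by rewrite divn_gt0 // dvdn_leq.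
      rewrite -[c j *+ j]mulr_natr -{1}(divnK jdk) natrM; field.
      by rewrite !pnatr_eq0 -!lt0n kj0 j0.
    by apply: pintM; [apply: IHk | apply: pint_invn].
  by rewrite mul0r; apply: pint0.
case: ifP => pk; first exact: cong.
by rewrite subr0; apply: pintM => //; apply: pint_invn; rewrite pk.
Qed.

(** Here F is the product of the (1 - z^(l j))^(- c_(l, j)); the factors with l, j <= N determine it
    up to degree N. *)
Lemma pint_of_exponents (c : nat -> fps rat) (s : fps rat) (F : fps rat) :
  F 0 = 1 -> dlog F s -> (forall l k, (0 < k)%N -> pint (c l k)) ->
  (forall n, (0 < n)%N -> s n = \sum_(1 <= l < n.+1) if (l %| n)%N
     then (\sum_(1 <= j < (n %/ l).+1) if (j %| n %/ l)%N then c l j *+ j else 0) *+ l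
     else 0) ->
  forall n, pint (F n).
Proof.
move=> F0 Fs pc sE N.
have [|G [G0 Gt pG]] := @has_pint_dlog_sum _ (index_iota 1 N.+1) predT
  (fun l => \sum_(j <- index_iota 1 N.+1) if (0 < l * j)%N
     then fps_scale (c l j) (geom_dlog 1 (l * j)) else 0).
  move=> l _; apply: has_pint_dlog_sum => j _; case: ifP => [lj|_].
    by apply: has_pint_dlog_geom => //; apply: pc; case: j lj; rewrite ?muln0.
  exact: has_pint_dlog0.
rewrite (dlog_local rat_mulrn_inj F0 G0 Fs Gt (N := N)) // => n nN.
rewrite fps_sum; under [RHS]eq_bigr do rewrite fps_sum.
case: (posnP n) => [->|n0].
  rewrite (dlog0 F0 Fs) big1 // => l _; rewrite big1 // => j _.
  by case: ifP; rewrite ?fps0 // /fps_scale /geom_dlog mulr0.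
rewrite sE // -(@sum_dvd_widen _ _ _ N) ?n0 //;
  apply: eq_big_nat => l /andP[l0 lN].
case: ifP => ln; last first.
  rewrite big1 // => j _; case: ifP => // _;
    rewrite /fps_scale /geom_dlog n0 /=.
  rewrite ifF ?mulr0 //; apply: contraFF ln => /(dvdn_trans _); apply.
  exact: dvdn_mulr.
rewrite -(@sum_dvd_widen _ _ _ N); last first.
  by rewrite divn_gt0 // dvdn_leq //= (leq_trans (leq_div _ _)).
rewrite -sumrMnl; apply: eq_big_nat => j /andP[j0 jN].
rewrite muln_gt0 l0 j0 /= /fps_scale /geom_dlog n0 /= expr1n mulnC -dvdn_divRL //.
by case: ifP => _; rewrite ?mulr0 ?mul0rn // mulr_natr mulrnA.
Qed.

End Pint.

(** * Embedding of the p-integral rationals into the p-adic integers *)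

Section PadicEmbedding.
Variables (p : nat) (p_prime : prime p).

Lemma pint_denq x : pint p x -> ~~ (p %| `|denq x|)%N.
Proof.
move=> [b pb /intrP[z xb]]; apply: contra pb => /dvdn_trans; apply.
have eq_int : numq x * b%:Z = z * denq x.
  apply: (@intr_inj rat); rewrite !intrM -xb -{2}(divq_num_den x) mulrAC.
  by rewrite divfK // intr_eq0 denq_neq0.
have : (`|denq x| %| `|numq x| * b)%N.
  by rewrite -[b]/(`|b%:Z|%N) -abszM eq_int abszM dvdn_mull.
by rewrite Gauss_dvdr // coprime_sym coprime_num_den.
Qed.

(** The inverses of b modulo the powers of p are compatible, since inverses are unique. *)
Lemma padic_inv_nat b : ~~ (p %| b)%N ->
  exists u : padic_int p_prime, u * b%:R = 1.
Proof.
move=> pb; pose u n : 'Z_(p ^ n.+1) := (b%:R)^-1.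
have b_unit n : (b%:R : 'Z_(p ^ n.+1)) \is a GRing.unit.
  by rewrite unitZpE ?Zpow_gt1 // coprimeXl // prime_coprime.
have uV n : u n * b%:R = 1 by rewrite mulVr ?b_unit.
have uP n : Zpow_red (u n.+1) = u n.
  apply: (mulIr (b_unit n)); transitivity (Zpow_red (u n.+1 * b%:R)).
    by rewrite (Zpow_redM p_prime) Zpow_red_nat.
  by rewrite !uV Zpow_red1.
exists (@PadicInt p p_prime u uP); apply: padic_int_eq => n.
by rewrite -[LHS]/(u n * (b%:R : padic_int p_prime) n) padic_proj_nat uV.
Qed.

Lemma pint_padic x : pint p x ->
  exists g : padic_int p_prime, ratr x = tofrac g :> padic p_prime.
Proof.
move=> /pint_denq pd; have [u ud] := padic_inv_nat pd.
exists ((numq x)%:~R * u); rewrite rmorphM rmorph_int /ratr; congr (_ * _).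
have dE : (denq x)%:~R = `|denq x|%:R :> padic p_prime.
  by rewrite -[RHS]/((`|denq x|%:Z)%:~R) gez0_abs // ltW // denq_gt0.
have d0 : (denq x)%:~R != 0 :> padic p_prime.
  by rewrite dE padic_natr_eq0 absz_eq0 denq_neq0.
apply: (mulIf d0);
  rewrite mulVf // dE -(rmorph_nat (@tofrac (padic_int p_prime))).
by rewrite -rmorphM ud rmorph1.
Qed.

Lemma pint_in_padic_int_fps F :
  (forall n, pint p (F n)) -> in_padic_int_fps p_prime F.
Proof.
move=> pF; exists (fun n => projT1 (cid (pint_padic (pF n)))) => n.
by case: cid.
Qed.

End PadicEmbedding.

(** * Dwork's congruences for the remaining terms of h *)

Section Dwork.
Variables (p q d : nat) (p_prime : prime p).
Hypotheses (q_gt0 : (0 < q)%N) (p_ndvd_q : ~~ (p %| q)%N).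
Hypothesis d_order : d.-primitive_root (q%:R : 'F_p).

Lemma dvdn_order k : (p %| q ^ k - 1)%N = (d %| k)%N.
Proof.
rewrite (prim_order_dvd d_order) (dvdn_pcharf (pchar_Fp p_prime)).
by rewrite natrB ?expn_gt0 ?q_gt0 // natrX subr_eq0.
Qed.

(** By Fermat's little theorem, d divides p - 1. *)
Lemma order_coprime : coprime d p.
Proof.
have dp : (d %| p.-1)%N.
  rewrite -dvdn_order -eqn_mod_dvd ?expn_gt0 ?q_gt0 // -totient_prime //.
  by apply/eqP/Euler_exp_totient; rewrite coprime_sym prime_coprime.
have p1 := prime_gt1 p_prime.
rewrite coprime_sym prime_coprime // gtnNdvd ?(prim_order_gt0 d_order) //.
by apply: leq_ltn_trans (dvdn_leq _ dp) _; lia.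
Qed.

Let x : rat := q%:R^-1.

Let q_neq0 : q%:R != 0 :> rat. Proof. by rewrite pnatr_eq0 -lt0n. Qed.

Lemma pint_qinvX k : pint p (x ^+ k).
Proof. exact/pintX/pint_invn. Qed.

Lemma pint_geom_inv k : ~~ (d %| k)%N -> pint p (x ^+ k - 1)^-1 /\ x ^+ k - 1 != 0.
Proof.
move=> dk; have pk : ~~ (p %| q ^ k - 1)%N by rewrite dvdn_order.
have qk : (q ^ k - 1)%:R = q%:R ^+ k - 1 :> rat.
  by rewrite natrB ?expn_gt0 ?q_gt0 // natrX.
have qk0 : q%:R ^+ k - 1 != 0 :> rat.
  by rewrite -qk pnatr_eq0; apply: contraNneq pk => ->; rewrite dvdn0.
have xkE : x ^+ k - 1 = - (q%:R ^+ k - 1) / q%:R ^+ k.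
  by rewrite /x exprVn; field; apply: expf_neq0.
split; last by rewrite xkE mulf_neq0 ?oppr_eq0 // invr_eq0 expf_neq0.
rewrite xkE invfM invrK invrN mulNr -qk -natrX.
by apply/pintN/(pintM p_prime); [apply: pint_invn | apply: pint_nat].
Qed.

(** Write k = m p^r with m prime to p. Then k - k/p = m phi(p^r), and Euler's theorem makes q^(k -
    k/p) - 1 divisible by p^r, the whole p-part of k. *)
Lemma qinvX_cong k : (0 < k)%N -> (p %| k)%N ->
  pint p ((x ^+ k - x ^+ (k %/ p)) / k%:R).
Proof.
move=> k0 pk; set k' := (k %/ p)%N; have p0 := prime_gt0 p_prime.
have r0 : (0 < logn p k)%N by rewrite logn_gt0 mem_primes p_prime k0.
have [m pm kE] := pfactor_coprime p_prime k0.
set r := logn p k in r0 kE.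
have k'E : k' = (m * p ^ r.-1)%N.
  by rewrite /k' {1}kE -{1}(prednK r0) expnSr mulnA mulnK.
have kk' : k = (k' + m * totient (p ^ r))%N.
  rewrite k'E totient_pfactor // -mulnDr {1}kE -{1}(prednK r0) expnS.
  by rewrite -mulSn prednK.
have : (p ^ r %| q ^ (k - k') - 1)%N.
  rewrite -eqn_mod_dvd ?expn_gt0 ?q_gt0 // kk' addKn mulnC expnM.
  rewrite -modnXm Euler_exp_totient; last first.
    by rewrite coprime_sym coprimeXl // prime_coprime.
  by rewrite modnXm exp1n.
move=> /dvdnP[u uE].
have m0 : m%:R != 0 :> rat.
  by rewrite pnatr_eq0 -lt0n; move: k0; rewrite {1}kE muln_gt0 => /andP[].
have pr0 : (p ^ r)%:R != 0 :> rat by rewrite pnatr_eq0 -lt0n expn_gt0 p0.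
have qkk : q%:R ^+ k = q%:R ^+ k' * (1 + u%:R * (p ^ r)%:R) :> rat.
  have k'k : (k' <= k)%N by rewrite kk' leq_addr.
  rewrite -{1}(subnKC k'k) exprD; congr (_ * _).
  by rewrite -natrX -natrM -uE natrB ?expn_gt0 ?q_gt0 // addrC subrK.
have qk0 n : q%:R ^+ n != 0 :> rat by apply: expf_neq0.
(* As x^k - x^k' = - u p^r x^k, division by k = m p^r leaves only the denominators m and q^k, both
   prime to p. *)
have -> : (x ^+ k - x ^+ k') / k%:R = - (u%:R / m%:R * x ^+ k).
  have u0 : 1 + u%:R * (p ^ r)%:R != 0 :> rat.
    by have := qk0 k; rewrite qkk mulf_eq0 negb_or => /andP[].
  rewrite /x !exprVn qkk {1}kE natrM; move: (q%:R ^+ k') (qk0 k') u0 pr0 m0.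
  move: u%:R m%:R (p ^ r)%:R => a b c y y0 ac0 c0 b0.
  by field; rewrite y0 ac0 c0 b0.
apply/pintN/(pintM p_prime); last exact: pint_qinvX.
apply: (pintM p_prime); first exact: pint_nat.
by apply: pint_invn; rewrite -prime_coprime.
Qed.

Definition dwork_coef (v : {poly int}) k : rat :=
  if (d %| k)%N then 0 else ev (x ^+ k) v / (x ^+ k - 1).

Lemma pint_dwork_coef v k : pint p (dwork_coef v k).
Proof.
rewrite /dwork_coef; case: ifP => [_|/negbT dk]; first exact: pint0.
apply: (pintM p_prime); last by have [] := pint_geom_inv dk.
by apply: pint_ev => //; apply: pint_qinvX.
Qed.

(** As d is prime to p, it divides k exactly when it divides k/p, so both coefficients fall into the
    same case. If nonzero terms remain, their difference is a p-integral multiple of x^k -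
    x^(k/p). *)
Lemma dwork_coef_cong v k : (0 < k)%N -> (p %| k)%N ->
  pint p ((dwork_coef v k - dwork_coef v (k %/ p)%N) / k%:R).
Proof.
move=> k0 pk; rewrite /dwork_coef.
have -> : (d %| k %/ p)%N = (d %| k)%N.
  by rewrite -[in RHS](divnK pk) Gauss_dvdl // order_coprime.
case: ifP => [_|/negbT dk]; first by rewrite subrr mul0r; apply: pint0.
have dk' : ~~ (d %| k %/ p)%N.
  by apply: contra dk => /dvdn_trans; apply; rewrite -{2}(divnK pk) dvdn_mulr.
have [px x0] := pint_geom_inv dk; have [py y0] := pint_geom_inv dk'.
have xy := qinvX_cong k0 pk.
have [e pe] := ev_sub_pint p_prime v (pint_qinvX k) (pint_qinvX (k %/ p)).
have pb := pint_ev p_prime v (pint_qinvX (k %/ p)).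
have kr0 : k%:R != 0 :> rat by rewrite pnatr_eq0 -lt0n.
move: (ev (x ^+ k) v) (ev (x ^+ (k %/ p)) v) pb => a b pb.
move: (x ^+ k) (x ^+ (k %/ p)) k%:R x0 y0 px py xy kr0.
move=> y z c y1 z1 py pz yz c0 abE.
have -> : (a / (y - 1) - b / (z - 1)) / c =
    (y - z) / c * (e * (y - 1)^-1 - b * ((y - 1)^-1 * (z - 1)^-1)).
  rewrite (_ : a = b + (y - z) * e); last by rewrite -abE addrC subrK.
  by field; rewrite y1 z1 c0.
apply: (pintM p_prime) => //; apply: (pintB p_prime);
  apply: (pintM p_prime) => //.
exact: pintM.
Qed.

End Dwork.

(** * Integrality of the exponential of h(q, z) - h(q^d, z^d) / d *)

Theorem theorem2p10 (p q d : nat) (p_prime : prime p) (q_pp : prime_power q)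
    (p_ndvd_q : ~~ (p %| q)%N) (q_neq1 : (q != 1 %[mod p])%N)
    (d_order : d.-primitive_root (q%:R : 'F_p)) :
  in_padic_int_fps p_prime
    (fps_exp (fps_sub (hser q%:R)
       (fps_scale (1 / d%:R) (fps_substX d (hser (q%:R ^+ d)))))).
Proof.
have q1 : (1 < q)%N.
  have [r [k [r_prime k0 ->]]] := q_pp.
  by rewrite -(exp1n k) ltn_exp2r // prime_gt1.
have q0 : (0 < q)%N by apply: ltnW.
have d0 := prim_order_gt0 d_order.
have Q0 : q%:R != 0 :> rat by rewrite pnatr_eq0 -lt0n.
have Q1 n : (0 < n)%N -> q%:R ^+ n != 1 :> rat.
  by move=> n0; rewrite -natrX pnatr_eq1 gtn_eqF // -(expn0 q) ltn_exp2l.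
have [v vE] := hdiff_exponents.
(* For each l, [c l j] is the exponent of 1 / (1 - z^(l j)) in the product expansion of the
   exponential. *)
have /choice [c cP] (l : nat) : exists c : fps rat,
    (forall k, (0 < k)%N -> pint p (c k)) /\
    (forall k, (0 < k)%N -> dwork_coef q d (v l) k =
      \sum_(1 <= j < k.+1) if (j %| k)%N then c j *+ j else 0).
  have [c pc cE] := pint_exponents p_prime
    (pint_dwork_coef p_prime q0 p_ndvd_q d_order (v l))
    (dwork_coef_cong p_prime q0 p_ndvd_q d_order (v l)).
  by exists c.
set H := fps_sub _ _.
have H0 : H 0 = 0.
  have hser0 Q : hser Q 0 = 0 by rewrite /hser /fps_log fps_comp0 invr0 mulr0.
  by rewrite /H /fps_sub /fps_scale /fps_substX dvdn0 div0n !hser0 mulr0 subr0.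
apply: pint_in_padic_int_fps.
apply: (pint_of_exponents p_prime (c := c) (fps_exp0 H) (dlog_exp H0)).
  by move=> l; have [] := cP l.
move=> n n0; rewrite vE //; apply: eq_big_nat => l /andP[l0 _].
case: ifP => // ln; congr (_ *+ _); have [_ <-] := cP l; first by [].
by rewrite divn_gt0 // dvdn_leq.
Qed.
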